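(* Let $D$ be a digraph with adjacency matrix $A$ of spectral radius $\rho>0$, and irreducible components $D_1,\ldots,D_t$ with adjacency matrices $A_1,\ldots,A_t$, ordered so that $A_i$ has spectral radius $\rho$ if and only if $i\le s$. For $1\le i\le s$ let $p_i$ be the period of $D_i$ and $P_{i,1},\ldots,P_{i,p_i}$ its periodic classes, indexed so that every arc of $D_i$ goes from $P_{i,j}$ to $P_{i,j+1}$ (second index mod $p_i$). Let $P=\prod_{i=1}^s p_i$. For $1\le i\le s$, $1\le j\le p_i$ let $V_{i,j}$ be the set of vertices $w$ such that in $D^{p_i}$ there is a walk (possibly of length $0$) from $w$ to $P_{i,j}$ or from $P_{i,j}$ to $w$, and let $v_L^{\langle i,j\rangle}, v_R^{\langle i,j\rangle}$ be left and right $\rho^{p_i}$-eigenvectors of the $V_{i,j}$-mask of $A^{p_i}$ normalized so that $v_L^{\langle i,j\rangle}v_R^{\langle i,j\rangle}=1$. Suppose that for all $1\le a,b\le s$ with $a\neq b$ there is no walk in $D$ from a vertex of $D_a$ to a vertex of $D_b$. Then for every row vector $w_L$, column vector $w_R$ and integer $k\ge0$ there exist $C,\epsilon>0$ such that for all $m$ $$w_LA^{Pm+k}w_R=\left(q(m)+\sum_{i=1}^s\sum_{j=1}^{p_i}\big(w_Lv_R^{\langle i,j\rangle}\big)\big(v_L^{\langle i,j+k\rangle}w_R\big)\right)\rho^{Pm+k},$$ where $|q(m)|<C(1-\epsilon)^m$ and the index $j+k$ is taken modulo $p_i$.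
   Context: A digraph has vertex set $\{1,\ldots,n\}$ and a multiset of arcs; its adjacency matrix has $(u,v)$ entry equal to the multiplicity of arc $(u,v)$. Walks may have length $0$. Irreducible components are maximal vertex sets (with induced subdigraphs) in which every vertex reaches every other by a walk. An irreducible digraph is $p$-cyclic if its vertices partition into classes $P_1,\ldots,P_p$ with every arc going from $P_j$ to $P_{j+1}$ (indices mod $p$); its period is the largest such $p$ and these classes are its periodic classes. $D^r$ is the digraph on the same vertex set whose arcs from $a$ to $b$ correspond to walks of length $r$ from $a$ to $b$ in $D$ (adjacency matrix $A^r$). For a vertex set $S$, the $S$-mask of a matrix $M$ agrees with $M$ on entries with both row and column in $S$ and is $0$ elsewhere.
   Formalization: When some p_i does not divide k, the eigenvectors must also satisfy v_L^{<i,j>}A = ρ v_L^{<i,j+1>} for that i (v_L v_R = 1 alone leaves free scalars that make the formula false, e.g. on a directed 2-cycle); such a scaling is proved always to exist. *)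

(* Defs.v *)
From mathcomp Require Import all_boot all_order all_algebra.
From mathcomp Require Import reals.
From mathcomp Require Import complex.

Set Implicit Arguments.
Unset Strict Implicit.
Unset Printing Implicit Defensive.

Import Order.TTheory GRing.Theory Num.Theory.
Local Open Scope ring_scope.
Local Open Scope complex_scope.

(* A digraph on 'I_n is a finite multiset of arcs, given by its multiplicity
   matrix.  Since 'M[nat]_n is a semiring, D ^+ r is the digraph D^r: its (a, b)
   entry counts the walks of length r from a to b. *)
Definition digraph (n : nat) := 'M[nat]_n.

Definition adjmx (R : realType) (n : nat) (D : digraph n) : 'M[R[i]]_n :=
  map_mx (fun k : nat => k%:R) D.

Definition arc (n : nat) (D : digraph n) : rel 'I_n :=
  fun u v => (0 < D u v)%N.

(* connect is the reflexive transitive closure, so walks of length 0 count. *)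
Definition walk (n : nat) (D : digraph n) : rel 'I_n := connect (arc D).

Definition induced (n : nat) (D : digraph n) (S : {set 'I_n}) : digraph #|S| :=
  mxsub (@enum_val _ (mem S)) (@enum_val _ (mem S)) D.

Definition irreducible_digraph (n : nat) (D : digraph n) : bool :=
  [forall u, forall v, walk D u v].

Definition component (n : nat) (D : digraph n) (S : {set 'I_n}) : bool :=
  maxset (fun T : {set 'I_n} => irreducible_digraph (induced D T)) S.

(* The set of moduli is finite, so for n > 0 this supremum is a maximum; it is 0
   for the empty matrix. *)
Definition spectral_radius (R : realType) (n : nat) (M : 'M[R[i]]_n) : R :=
  sup (fun r : R => exists2 a : R[i], eigenvalue M a & `|a| = r%:C).

(* Classes are indexed by the residues 0, ..., p - 1; values of cl beyond p - 1
   are irrelevant. *)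
Definition cyclic_classes (n : nat) (D : digraph n) (S : {set 'I_n}) (p : nat)
    (cl : nat -> {set 'I_n}) : Prop :=
  [/\ (0 < p)%N,
      \bigcup_(j < p) cl j = S,
      forall j, (j < p)%N -> cl j != set0,
      forall j l, (j < p)%N -> (l < p)%N -> j <> l -> [disjoint cl j & cl l]
    & forall u v, u \in S -> v \in S -> arc D u v ->
        forall j, (j < p)%N -> u \in cl j -> v \in cl (j.+1 %% p)%N].

Definition is_period (n : nat) (D : digraph n) (S : {set 'I_n}) (p : nat) : Prop :=
  (exists cl, cyclic_classes D S p cl) /\
  forall q, (exists cl, cyclic_classes D S q cl) -> (q <= p)%N.

Definition reach_set (n : nat) (D : digraph n) (S : {set 'I_n}) : {set 'I_n} :=
  [set w | [exists u in S, walk D w u || walk D u w]].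

Definition set_mask (R : realType) (n : nat) (S : {set 'I_n}) (M : 'M[R[i]]_n) :
    'M[R[i]]_n :=
  \matrix_(u, v) if (u \in S) && (v \in S) then M u v else 0.

Definition left_eigenvector (R : realType) (n : nat) (M : 'M[R[i]]_n)
    (a : R[i]) (x : 'rV[R[i]]_n) : Prop :=
  x != 0 /\ x *m M = a *: x.

Definition right_eigenvector (R : realType) (n : nat) (M : 'M[R[i]]_n)
    (a : R[i]) (x : 'cV[R[i]]_n) : Prop :=
  x != 0 /\ M *m x = a *: x.

Definition pairing (R : realType) (n : nat) (x : 'rV[R[i]]_n)
    (y : 'cV[R[i]]_n) : R[i] := (x *m y) 0 0.

(* Coherent normalization of left eigenvectors x 0, ..., x (p - 1) attached to
   the p classes of a cycle.  Normalizing each class separately by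
   pairing (x j) (y j) = 1 leaves one free scalar per class, and a product
   pairing wL (y j) * pairing (x l) wR with j <> l depends on these scalars: for
   the directed 2-cycle, whose masks have rank 1, independent rescalings of the
   two classes change it. *)
Definition coherent (R : realType) (n : nat) (M : 'M[R[i]]_n) (rho : R)
    (p : nat) (x : nat -> 'rV[R[i]]_n) : Prop :=
  forall j, (j < p)%N -> x j *m M = rho%:C *: x (j.+1 %% p)%N.

(* Main.v *)
Require Import Defs.
From mathcomp Require Import all_boot all_order all_algebra.
From mathcomp Require Import reals.
From mathcomp Require Import complex.

From mathcomp Require Import boolp zify ring.

Set Implicit Arguments.
Unset Strict Implicit.
Unset Printing Implicit Defensive.

Import Order.TTheory GRing.Theory Num.Theory.
Local Open Scope ring_scope.
Local Open Scope complex_scope.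

(** Reversing all arcs exchanges right and left eigenvectors, so everything is
    done for right eigenvectors.  If [Q y = mu y] with [0 <= Q <= A ^+ k] and
    [|mu| >= rho ^+ k], pick a vertex of the support of [y] that reaches as few
    vertices as possible: [y] vanishes strictly beyond its component [S], and
    pairing [|y|] with the left Perron vector of [S] shows that [S] has spectral
    radius [rho] and that the triangle inequality [|Q y| <= A ^+ k |y|] is an
    equality on [S].  Since [A ^+ (p * N)] is positive on each periodic class,
    this forces the mask eigenvectors to be multiples of the Perron vector on
    their class (hence unique up to a scalar), and any further eigenvector of
    [A ^+ P] of modulus at least [rho ^+ P] orthogonal to all left mask
    eigenvectors to be zero.  So, for [Pi] the sum of the [vR *m vL], the matrix
    [A ^+ P / rho ^+ P - Pi] has all its eigenvalues in the open unit disc and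
    its powers decay geometrically.  Perron's theorem is itself derived from
    that decay. *)

(** * Decay of matrix powers and Perron vectors *)

Section PowerBounds.
Variable C : numClosedFieldType.

(** Induction on the factors: (N - a) x is annihilated by the remaining ones, and N^(m+1) x = N^m (N
    - a) x + a N^m x turns a bound for it into one for x. This takes the place of a Jordan form. *)
Lemma annihilated_power_bound n (N : 'M[C]_n) (c : C) (rs : seq C)
    (x : 'cV[C]_n) :
    0 < c -> (forall a, a \in rs -> `|a| < c) ->
    (\prod_(a <- rs) (N - a%:M)) *m x = 0 ->
  exists2 K : C, 0 <= K & forall m i, `|(N ^+ m *m x) i 0| <= K * c ^+ m.
Proof.
move=> c0; elim/last_ind: rs x => [|rs a IH] x rsc.
  rewrite big_nil mul1mx => ->; exists 0 => // m i.
  by rewrite mulmx0 mxE normr0 mul0r.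
rewrite big_rcons /= -mulmxE -mulmxA => /IH [b bs|K K0 HK].
  by apply: rsc; rewrite mem_rcons inE bs orbT.
have ac : `|a| < c by apply: rsc; rewrite mem_rcons inE eqxx.
have ca0 : 0 < c - `|a| by rewrite subr_gt0.
set S := \sum_i `|x i 0|.
have S0 : 0 <= S by apply: sumr_ge0.
(* The first summand makes the recursion close, that is K + |a| K' <= K' c; the second covers m =
   0. *)
exists (K / (c - `|a|) + S); first by rewrite addr_ge0 // divr_ge0 // ltW.
set K' := _ + S.
have K'0 : 0 <= K' by rewrite addr_ge0 // divr_ge0 // ltW.
have KK' : K + `|a| * K' <= K' * c.
  rewrite -lerBrDr mulrC -mulrBl -ler_pdivrMl // mulrC.
  by rewrite lerDl.
elim=> [|m IHm] i.
  rewrite mul1mx expr0 mulr1 (le_trans (y := S)) //.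
    by rewrite /S (bigD1 i) //= lerDl sumr_ge0.
  by rewrite lerDr divr_ge0 // ltW.
have -> : (N ^+ m.+1 *m x) = N ^+ m *m ((N - a%:M) *m x) + a *: (N ^+ m *m x).
  rewrite exprSr -mulmxE -mulmxA mulmxBl mulmxBr scalemxAr -addrA.
  by rewrite mul_scalar_mx addNr addr0.
rewrite mxE (le_trans (ler_normD _ _)) // [X in `|X|]mxE.
rewrite [X in _ + `|X|]mxE normrM exprS mulrA.
apply: le_trans (_ : (K + `|a| * K') * c ^+ m <= _).
  rewrite mulrDl lerD //; first by have := HK m i; rewrite [in X in X -> _]mxE.
  by rewrite -mulrA ler_wpM2l.
by apply: ler_wpM2r => //; rewrite exprn_ge0 // ltW.
Qed.

Lemma max_norm_seq (rs : seq C) : rs != [::] ->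
  exists2 a, a \in rs & forall b, b \in rs -> `|b| <= `|a|.
Proof.
elim: rs => // a [|b rs] IH _; first by exists a; rewrite ?inE // => b; rewrite inE => /eqP->.
have [d drs Hd] := IH isT.
have [da|ad] := real_leP (normr_real d) (normr_real a).
  exists a; first by rewrite inE eqxx.
  by move=> e; rewrite inE => /orP[/eqP->//|/Hd]; move/le_trans; apply.
exists d; first by rewrite inE drs orbT.
by move=> e; rewrite inE => /orP[/eqP->|/Hd //]; apply: ltW.
Qed.

Lemma char_poly_tr n (N : 'M[C]_n) : char_poly N^T = char_poly N.
Proof.
rewrite /char_poly -[in RHS]det_tr; congr (\det _).
by apply/matrixP=> i j; rewrite !mxE eq_sym.
Qed.

Lemma col_eigenvalue n (N : 'M[C]_n) (a : C) :
  root (char_poly N) a -> exists2 y : 'cV[C]_n, y != 0 & N *m y = a *: y.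
Proof.
rewrite -char_poly_tr -eigenvalue_root_char => /eigenvalueP[v vN v0].
exists v^T; first by rewrite -[0]trmx0 (inj_eq trmx_inj).
by rewrite -[N]trmxK -trmx_mul vN linearZ.
Qed.

Lemma char_poly_split n (N : 'M[C]_n) :
  exists rs : seq C, char_poly N = \prod_(z <- rs) ('X - z%:P).
Proof.
have [rs E] := closed_field_poly_normal (char_poly N); exists rs.
by rewrite {1}E (monicP (char_poly_monic N)) scale1r.
Qed.

(** By Cayley-Hamilton the product of the N - a over all eigenvalues a kills every basis column, so
    each column of N^m decays. *)
Lemma power_decay n (N : 'M[C]_n) :
    (forall a (y : 'cV[C]_n), y != 0 -> N *m y = a *: y -> `|a| < 1) ->
  exists c K : C, [/\ 0 < c, c < 1, 0 <= K &
    forall m i j, `|(N ^+ m) i j| <= K * c ^+ m].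
Proof.
case: n N => [|n] N HN.
  exists (2^-1), 0; split => //.
  - by rewrite invr_gt0.
  - by rewrite invf_lt1 // ltr1n.
  - by move=> m [].
have [rs E] := char_poly_split N.
have rs1 a : a \in rs -> `|a| < 1.
  move=> ars; have [|y y0 Hy] := @col_eigenvalue _ N a; last exact: HN Hy.
  by rewrite E root_prod_XsubC.
have [M [M0 M1 HM]] : exists M : C, [/\ 0 <= M, M < 1 & forall a, a \in rs -> `|a| <= M].
  have [->|/max_norm_seq[a ars amax]] := eqVneq rs [::]; first by exists 0.
  by exists `|a|; split=> //; apply: rs1.
(* The midpoint leaves room on both sides: every eigenvalue has modulus below [c], and [c] is below
   1. *)
pose c := (1 + M) / 2.
have c0 : 0 < c by rewrite divr_gt0 // ltr_wpDr.
have c1 : c < 1 by rewrite ltr_pdivrMr // mul1r -[2]/(1 + 1) ltrD2l.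
have Hc a : a \in rs -> `|a| < c.
  move=> /HM aM; apply: le_lt_trans aM _.
  by rewrite ltr_pdivlMr // mulrDr mulr1 ltrD2r.
have key j : exists K : C, 0 <= K /\ forall m i, `|(N ^+ m) i j| <= K * c ^+ m.
  have [|||K K0 HK] := @annihilated_power_bound _ N c rs (delta_mx j 0).
  - by [].
  - exact: Hc.
  - rewrite -[X in X *m _](_ : horner_mx N (char_poly N) = _).
      by rewrite Cayley_Hamilton mul0mx.
    rewrite E rmorph_prod; apply: eq_bigr => a _.
    by rewrite rmorphB /= horner_mx_X horner_mx_C.
  exists K; split=> // m i; have := HK m i.
  by rewrite -colE mxE.
have [K HK] := fin_all_exists key.
exists c, (\sum_j K j); split => //.
  by apply: sumr_ge0 => j _; case: (HK j).
move=> m i j; have [_ /(_ m i)/le_trans] := HK j; apply.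
rewrite ler_wpM2r ?exprn_ge0 ?(ltW c0) //.
by rewrite (bigD1 j) //= lerDl sumr_ge0 // => l _; case: (HK l).
Qed.

End PowerBounds.

Lemma col_eigenvalue_root (C : numClosedFieldType) n (N : 'M[C]_n) (a : C)
    (y : 'cV[C]_n) : y != 0 -> N *m y = a *: y -> root (char_poly N) a.
Proof.
move=> y0 Ny; rewrite -char_poly_tr -eigenvalue_root_char; apply/eigenvalueP; exists y^T.
  by rewrite -trmx_mul Ny linearZ.
by rewrite -[0]trmx0 (inj_eq trmx_inj).
Qed.

Lemma complex_power_small (R : realType) (c K x : R[i]) :
  0 < c -> c < 1 -> 0 <= K -> 0 < x -> exists m, K * c ^+ m < x.
Proof.
move=> c0 c1 K0 x0.
rewrite -(RRe_real (gtr0_real c0)) -(RRe_real (gtr0_real x0)).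
rewrite -(RRe_real (ger0_real K0)).
move: c0 c1 K0 x0; rewrite !ltcE lecE /=.
move=> /andP[_ c0] /andP[_ c1] /andP[_ K0] /andP[_ x0].
set k := complex.Re K in K0 *; set a := complex.Re c in c0 c1 *; set z := complex.Re x in x0 *.
have d0 : 0 < a^-1 - 1 by rewrite subr_gt0 invf_gt1.
(* Bernoulli's inequality: the powers of [a^-1] grow at least linearly, and the Archimedean property
   then supplies [m]. *)
have bern m : 1 + m%:R * (a^-1 - 1) <= a ^- m.
  elim: m => [|m IH]; first by rewrite mul0r addr0 expr0 invr1.
  rewrite -exprVn exprS exprVn.
  apply: le_trans (_ : a^-1 * (1 + m%:R * (a^-1 - 1)) <= _); last first.
    by rewrite ler_wpM2l // invr_ge0 ltW.
  set d := a^-1 - 1 in d0 *; have -> : a^-1 = 1 + d by rewrite addrC subrK.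
  rewrite -subr_ge0 (_ : _ - _ = m%:R * (d * d)); last by rewrite mulrSr; ring.
  by rewrite !mulr_ge0 // ltW.
exists (Num.bound (k / z / (a^-1 - 1))).
set m := Num.bound _.
have : k / z / (a^-1 - 1) < m%:R.
  by apply: archi_boundP; rewrite !divr_ge0 // ltW.
rewrite ltr_pdivrMr // => km.
rewrite -rmorphXn -rmorphM /= ltcR.
have am0 : 0 < a ^+ m by rewrite exprn_gt0.
rewrite -ltr_pdivlMr //; move: km; rewrite ltr_pdivrMr // mulrC => /lt_le_trans; apply.
rewrite ler_wpM2l ?(ltW x0) //; apply: le_trans (bern m).
by rewrite lerDr.
Qed.

(** If all eigenvalues had modulus below c, the powers of N = A / c would tend to 0, whereas
    subinvariance gives N^m g >= g for all m. *)
Lemma subinvariant_eigenvalue (R : realType) n (A : 'M[R[i]]_n) (g : 'cV[R[i]]_n)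
    (c : R[i]) (i0 : 'I_n) :
    (forall i j, 0 <= A i j) -> (forall i, 0 <= g i 0) -> 0 < g i0 0 -> 0 < c ->
    (forall i, c * g i 0 <= (A *m g) i 0) ->
  exists2 a, root (char_poly A) a & c <= `|a|.
Proof.
move=> A0 g0 gi0 c0 Ag.
have [rs E] := char_poly_split A.
case: (boolP (has (fun a => c <= `|a|) rs)) => [/hasP[a ars ca]|].
  by exists a => //; rewrite E root_prod_XsubC.
move/hasPn=> Hrs; exfalso.
set N := c^-1 *: A.
have Ng m i : g i 0 <= (N ^+ m *m g) i 0.
  elim: m i => [|m IH] i; first by rewrite mul1mx.
  rewrite exprS -mulmxE -mulmxA /N -scalemxAl mxE.
  rewrite -ler_pdivrMl ?invr_gt0 // invrK (le_trans (Ag i)) //.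
  by rewrite !mxE ler_sum // => j _; rewrite ler_wpM2l.
have [a y y0 Ny|c' [K [c'0 c'1 K0 HK]]] := @power_decay _ _ N.
  have ra : root (char_poly A) (c * a).
    apply: (col_eigenvalue_root y0).
    by rewrite -scalerA -Ny /N -scalemxAl scalerA divff ?scale1r // gt_eqF.
  rewrite E root_prod_XsubC in ra; have := Hrs _ ra.
  rewrite -real_ltNge ?normr_real ?gtr0_real // normrM (ger0_norm (ltW c0)).
  by rewrite -[X in _ < X]mulr1 ltr_pM2l.
have S0 : 0 <= \sum_j g j 0 by apply: sumr_ge0.
have [m] := complex_power_small c'0 c'1 (mulr_ge0 K0 S0) gi0.
suff le : g i0 0 <= K * (\sum_j g j 0) * c' ^+ m.
  by move/(le_lt_trans le); rewrite ltxx.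
apply: le_trans (Ng m i0) _; rewrite mxE mulrAC mulr_sumr ler_sum // => j _.
rewrite ler_wpM2r // (le_trans _ (HK m i0 j)) //.
rewrite ger0_norm ?lexx //.
elim: (m) i0 j {gi0 HK S0} => [|l IH] i j; first by rewrite mxE; case: eqP.
rewrite exprS -mulmxE mxE sumr_ge0 // => k _.
by rewrite mulr_ge0 // mxE mulr_ge0 // invr_ge0 ltW.
Qed.

(** Take the modulus z of an eigenvector for an eigenvalue of largest modulus r, so that A z >= r z.
    A strict inequality anywhere, smoothed by a positive matrix commuting with A, would yield an
    eigenvalue of modulus above r. *)
Lemma perron_col (R : realType) n (A : 'M[R[i]]_n.+1) :
    (forall i j, 0 <= A i j) -> (forall i j, exists m, 0 < (A ^+ m) i j) ->
  exists r (u : 'cV[R[i]]_n.+1),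
    [/\ 0 <= r, forall i, 0 < u i 0 & A *m u = r *: u].
Proof.
move=> A0 Airr.
have [rs E] := char_poly_split A.
have rs0 : rs != [::].
  apply/eqP=> rs0; have := size_char_poly A.
  by rewrite E rs0 big_nil size_poly1.
have [l lrs lmax] := max_norm_seq rs0.
have [|y y0 Ay] := @col_eigenvalue _ _ A l; first by rewrite E root_prod_XsubC.
set r := `|l|; set z : 'cV[R[i]]_n.+1 := map_mx Num.norm y.
have z0 i : 0 <= z i 0 by rewrite mxE.
set w := A *m z - r *: z.
have w0 i : 0 <= w i 0.
  have := congr1 (fun M : 'cV[_]_n.+1 => `|M i 0|) Ay.
  rewrite !mxE normrM subr_ge0 => <-.
  apply: le_trans (ler_norm_sum _ _ _) _; apply: ler_sum => j _.
  by rewrite normrM ger0_norm // mxE.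
have [f Hf] : exists f : 'I_n.+1 * 'I_n.+1 -> nat, forall ij, 0 < (A ^+ f ij) ij.1 ij.2.
  by apply: (fin_all_exists (P := fun (ij : 'I_n.+1 * 'I_n.+1) (u : nat) => is_true (0 < (A ^+ u) ij.1 ij.2))) => -[i j]; apply: Airr.
have Ak0 k i j : 0 <= (A ^+ k) i j.
  elim: k i j => [|k IH] i j; first by rewrite mxE; case: eqP.
  by rewrite exprS -mulmxE mxE sumr_ge0 // => h _; rewrite mulr_ge0.
(* One power for each pair of indices makes [T] entrywise positive, and as a polynomial in [A] it
   commutes with [A]. *)
set T := \sum_ij A ^+ f ij.
have T0 i j : 0 < T i j.
  by rewrite /T summxE (bigD1 (i, j)) //= ltr_wpDr // ?sumr_ge0.
have TA : T *m A = A *m T.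
  rewrite mulmx_suml mulmx_sumr; apply: eq_bigr => ij _.
  by rewrite mulmxE -exprSr exprS.
have Tpos (x : 'cV[R[i]]_n.+1) : (forall i, 0 <= x i 0) -> x != 0 -> forall i, 0 < (T *m x) i 0.
  move=> x0 /cV0Pn[j xj] i; rewrite mxE (bigD1 j) //= ltr_wpDr ?sumr_ge0 //.
    by move=> k _; rewrite mulr_ge0 // ltW.
  by rewrite mulr_gt0 // lt_def xj x0.
have zn0 : z != 0.
  case/cV0Pn: y0 => j yj; apply/cV0Pn; exists j; by rewrite mxE normr_eq0.
have [w00|wn0] := eqVneq w 0.
  exists r, z; split; [exact: normr_ge0| |by apply/eqP; rewrite -subr_eq0 -/w w00].
  have Az : A *m z = r *: z by apply/eqP; rewrite -subr_eq0 -/w w00.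
  have Akz k : A ^+ k *m z = r ^+ k *: z.
    elim: k => [|k IH]; first by rewrite mul1mx expr0 scale1r.
    by rewrite exprS -mulmxE -mulmxA IH -scalemxAr Az scalerA exprSr.
  have Tz : T *m z = (\sum_ij r ^+ f ij) *: z.
    by rewrite mulmx_suml scaler_suml; apply: eq_bigr => ij _.
  move=> i; rewrite lt_def z0 andbT; have := Tpos _ z0 zn0 i.
  by rewrite Tz mxE; apply: contraTneq => ->; rewrite mulr0 ltxx.
exfalso; set g := T *m z; set h := T *m w.
have gp := Tpos _ z0 zn0; have hp := Tpos _ w0 wn0.
rewrite -/g -/h in gp hp.
have S0 : 0 <= \sum_i g i 0 / h i 0.
  by apply: sumr_ge0 => i _; rewrite divr_ge0 // ltW.
(* Small enough that d g <= h entrywise, whence A g = r g + h >= (r + d) g. *)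
set d := (1 + \sum_i g i 0 / h i 0)^-1.
have d0 : 0 < d by rewrite invr_gt0 ltr_wpDr.
have [|||||a Ea] := @subinvariant_eigenvalue _ _ A g (r + d) ord0 => //.
- by move=> i; exact/ltW/gp.
- by rewrite ltr_wpDl // normr_ge0.
- move=> i; have -> : A *m g = r *: g + h.
    rewrite /h /w mulmxBr -scalemxAr -/g /g addrC.
    by rewrite [T *m (A *m z)]mulmxA TA mulmxA subrK.
  rewrite mulrDl [X in _ <= X]mxE [X in _ <= X + _]mxE lerD2l.
  rewrite /d -ler_pdivlMl ?invr_gt0 ?ltr_wpDr // invrK.
  rewrite -ler_pdivrMr // (bigD1 i) //= addrCA lerDl addr_ge0 //.
  by apply: sumr_ge0 => j _; rewrite divr_ge0 // ltW.
have ar : `|a| <= r by apply: lmax; rewrite E root_prod_XsubC in Ea.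
by move=> /le_trans/(_ ar); rewrite gerDl => /(lt_le_trans d0); rewrite ltxx.
Qed.

(** * Walks, strong components and periods *)

Lemma trmx_exp (S : comPzSemiRingType) n (M : 'M[S]_n) k :
  (M ^+ k)^T = M^T ^+ k.
Proof.
elim: k => [|k IH]; first by rewrite trmx1.
by rewrite exprS exprSr -!mulmxE trmx_mul IH.
Qed.

Definition walk_of_length n (D : digraph n) (k : nat) : rel 'I_n :=
  fun u v => (0 < (D ^+ k) u v)%N.

(** Mutual reachability from a base point is easier to handle than maximality; [component_scc] and
    [componentE] identify the two notions. *)
Definition scc n (D : digraph n) (a : 'I_n) : {set 'I_n} :=
  [set w | walk D a w && walk D w a].

Section Walks.
Variables (n : nat) (D : digraph n).
Implicit Types (u v w : 'I_n) (k l : nat).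
Local Notation wk := (walk_of_length D).

Lemma walk_of_length0 u v : wk 0 u v = (u == v).
Proof. by rewrite /walk_of_length mxE; case: eqP. Qed.

Lemma walk_of_length1 u v : wk 1 u v = Defs.arc D u v.
Proof. by rewrite /walk_of_length expr1. Qed.

Lemma walk_of_lengthP k l u w :
  reflect (exists2 v, wk k u v & wk l v w) (wk (k + l) u w).
Proof.
rewrite /walk_of_length exprD -mulmxE mxE.
apply: (iffP idP) => [|[v kv lv]].
  case: (pickP (fun v => (0 < (D ^+ k) u v * (D ^+ l) v w)%N)) => [v|H].
    by rewrite muln_gt0 => /andP[]; exists v.
  rewrite big1 // => v _; apply/eqP; rewrite -leqn0 leqNgt; apply/negP.
  by rewrite -[(_ < _)%N]/(0 < (D ^+ k) u v * (D ^+ l) v w)%N H.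
rewrite (bigD1 v) //=; apply: ltn_addr.
by rewrite -[(_ < _)%N]/(0 < (D ^+ k) u v * (D ^+ l) v w)%N muln_gt0 kv lv.
Qed.

Lemma walk_of_length_cat k l u v w : wk k u v -> wk l v w -> wk (k + l) u w.
Proof. by move=> uv vw; apply/walk_of_lengthP; exists v. Qed.

Lemma walkP u v : reflect (exists k, wk k u v) (walk D u v).
Proof.
apply: (iffP connectP) => [[s]|[k]].
  elim: s u => [|w s IH] u /=; first by move=> _ ->; exists 0%N; rewrite walk_of_length0.
  move=> /andP[uw ws] /IH[//|k kw]; exists (1 + k)%N.
  by apply: walk_of_length_cat kw; rewrite walk_of_length1.
elim: k u => [|k IH] u; first by rewrite walk_of_length0 => /eqP->; exists [::].
rewrite -add1n => /walk_of_lengthP[w]; rewrite walk_of_length1 => uw /IH[s ws ->].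
by exists (w :: s) => //=; rewrite uw.
Qed.

Lemma walk_of_length_walk k u v : wk k u v -> walk D u v.
Proof. by move=> kuv; apply/walkP; exists k. Qed.

Lemma walk_refl u : walk D u u. Proof. exact: connect0. Qed.

Lemma walk_trans : transitive (walk D).
Proof. by move=> v u w; apply: connect_trans. Qed.

Lemma mem_scc a : a \in scc D a.
Proof. by rewrite inE !walk_refl. Qed.

Lemma sccE a b : b \in scc D a -> scc D b = scc D a.
Proof.
rewrite inE => /andP[ab ba]; apply/setP=> w; rewrite !inE.
by apply/andP/andP=> -[x y]; split; eauto using walk_trans.
Qed.

Lemma scc_walk a b c : b \in scc D a -> c \in scc D a -> walk D b c.
Proof. by rewrite !inE => /andP[_ ba] /andP[ac _]; apply: walk_trans ac. Qed.

Lemma scc_convex a b c w : b \in scc D a -> c \in scc D a ->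
  walk D b w -> walk D w c -> w \in scc D a.
Proof.
rewrite !inE => /andP[ab _] /andP[_ ca] bw wc.
by rewrite (walk_trans ab bw) (walk_trans wc ca).
Qed.

End Walks.

Lemma walk_of_length_pow n (D : digraph n) p k u v :
  walk_of_length (D ^+ p) k u v = walk_of_length D (p * k) u v.
Proof. by rewrite /walk_of_length exprM. Qed.

Lemma walk_powP n (D : digraph n) p u v :
  reflect (exists k, walk_of_length D (p * k) u v) (walk (D ^+ p) u v).
Proof.
by apply: (iffP (walkP _ _ _)) => -[k]; exists k; rewrite ?walk_of_length_pow // -walk_of_length_pow.
Qed.

Lemma walk_pow_walk n (D : digraph n) p u v : walk (D ^+ p) u v -> walk D u v.
Proof. by move/walk_powP=> [k] /walk_of_length_walk. Qed.

Lemma walk_of_length_tr n (D : digraph n) k u v :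
  walk_of_length (trmx D : digraph n) k u v = walk_of_length D k v u.
Proof.
by rewrite /walk_of_length -trmx_exp mxE.
Qed.

Lemma walk_tr n (D : digraph n) u v : walk (trmx D : digraph n) u v = walk D v u.
Proof.
by apply/walkP/walkP => -[k]; exists k; rewrite ?walk_of_length_tr // -walk_of_length_tr.
Qed.

Lemma scc_tr n (D : digraph n) a : scc (trmx D : digraph n) a = scc D a.
Proof. by apply/setP=> w; rewrite !inE !walk_tr andbC. Qed.

Lemma walk_induced n (D : digraph n) (S : {set 'I_n}) (x y : 'I_#|S|) :
  walk (induced D S) x y -> walk D (enum_val x) (enum_val y).
Proof.
case/connectP=> s; elim: s x => [|z s IH] x /=; first by move=> _ ->; apply: walk_refl.
move=> /andP[xz zs] /(IH _ zs); apply: walk_trans; apply: connect1.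
by move: xz; rewrite /Defs.arc !mxE.
Qed.

(** By [scc_convex], a walk between two vertices of a component never leaves it. *)
Lemma walk_scc_induced n (D : digraph n) a (x y : 'I_#|scc D a|) :
  walk (induced D (scc D a)) x y.
Proof.
have := scc_walk (enum_valP x) (enum_valP y).
case/walkP=> k; elim: k x => [|k IH] x.
  by rewrite walk_of_length0 => /eqP/enum_val_inj->; apply: walk_refl.
rewrite -add1n => /walk_of_lengthP[w]; rewrite walk_of_length1 => xw wy.
have wS : w \in scc D a.
  apply: scc_convex (enum_valP x) (enum_valP y) _ _; first exact: connect1.
  exact: walk_of_length_walk wy.
rewrite -(enum_rankK_in wS wS) in xw wy.
by apply: walk_trans (IH _ wy); apply: connect1; rewrite /Defs.arc !mxE.
Qed.

Lemma irreducible_walk n (D : digraph n) (T : {set 'I_n}) a b :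
  irreducible_digraph (induced D T) -> a \in T -> b \in T -> walk D a b.
Proof.
move=> /forallP irr aT bT.
have /forallP/(_ (enum_rank_in aT b))/walk_induced := irr (enum_rank_in aT a).
by rewrite !enum_rankK_in.
Qed.

Lemma component_scc n (D : digraph n) a : component D (scc D a).
Proof.
apply/maxsetP; split.
  by apply/forallP=> x; apply/forallP=> y; apply: walk_scc_induced.
move=> T irr sT; apply/eqP; rewrite eqEsubset sT andbT.
apply/subsetP=> b bT; have aT := subsetP sT _ (mem_scc D a).
by rewrite inE !(irreducible_walk irr).
Qed.

Lemma componentE n (D : digraph n) S a : component D S -> a \in S -> S = scc D a.
Proof.
move=> /maxsetP[irr maxS] aS; symmetry; apply: maxS.
  by apply/forallP=> x; apply/forallP=> y; apply: walk_scc_induced.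
by apply/subsetP=> b bS; rewrite inE !(irreducible_walk irr).
Qed.

(** * Walk lengths modulo the period of a component *)

Section Period.
Variables (n : nat) (D : digraph n) (a : 'I_n).
Local Notation S := (scc D a).
Local Notation wk := (walk_of_length D).

Lemma cyclic_classes_walk p cl j k u v : cyclic_classes D S p cl ->
  (j < p)%N -> u \in cl j -> v \in S -> wk k u v -> v \in cl ((j + k) %% p)%N.
Proof.
move=> [p0 clS _ _ clarc] jp ucl.
have uS : u \in S by rewrite -clS; apply/bigcupP; exists (Ordinal jp).
elim: k v => [|k IH] v vS; first by rewrite walk_of_length0 addn0 modn_small // => /eqP<-.
rewrite -addn1 => /walk_of_lengthP[w uw]; rewrite walk_of_length1 => wv.
have wS : w \in S.
  by apply: scc_convex uS vS (walk_of_length_walk uw) (connect1 _).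
have := clarc _ _ wS vS wv ((j + k) %% p)%N (ltn_pmod _ p0) (IH _ wS uw).
by rewrite -[X in (X %% p)%N]addn1 modnDml addnA.
Qed.

Lemma cyclic_classes_inj p cl j l u : cyclic_classes D S p cl ->
  (j < p)%N -> (l < p)%N -> u \in cl j -> u \in cl l -> j = l.
Proof.
move=> [_ _ _ dis _] jp lp uj ul; apply/eqP/negPn/negP => /eqP/(dis _ _ jp lp).
by rewrite disjoint_sym => /disjointFr/(_ ul); rewrite uj.
Qed.

Lemma cyclic_classes_sub p cl j : cyclic_classes D S p cl -> (j < p)%N ->
  {subset cl j <= S}.
Proof.
by move=> [_ <- _ _ _] jp u uj; apply/bigcupP; exists (Ordinal jp).
Qed.

Lemma cyclic_classes_cover p cl u : cyclic_classes D S p cl -> u \in S ->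
  exists2 j, (j < p)%N & u \in cl j.
Proof. by move=> [_ <- _ _ _] /bigcupP[j _ uj]; exists j. Qed.

Lemma cyclic_classes_dvdn p cl j k u v : cyclic_classes D S p cl ->
  (j < p)%N -> u \in cl j -> v \in cl j -> wk k u v -> (p %| k)%N.
Proof.
move=> clP jp uj vj kuv; have p0 : (0 < p)%N by case: clP.
have := cyclic_classes_walk clP jp uj (cyclic_classes_sub clP jp vj) kuv.
move/(cyclic_classes_inj clP jp (ltn_pmod _ p0) vj) => /eqP.
by rewrite -{1}(modn_small jp) -[X in (X %% p)%N == _]addn0 eqn_modDl mod0n eq_sym.
Qed.

Lemma closed_walk_mul q k : wk k a a -> wk (q * k) a a.
Proof.
move=> kL; elim: q => [|q IH]; first by rewrite mul0n walk_of_length0.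
by rewrite mulSn; apply: walk_of_length_cat kL IH.
Qed.

(** This excludes a single vertex without a loop, which has period 1 but no closed walk of positive
    length. *)
Hypothesis closed_walk : exists2 k, (0 < k)%N & wk k a a.

(* The differences of lengths of closed walks at a form a group dZ, and walk
   lengths from a modulo d give d cyclic classes, so d is the period. *)
Lemma period_difference p : is_period D S p ->
  exists b, wk (p * b) a a /\ wk (p * b.+1) a a.
Proof.
move=> [[cl clP] pmax].
pose diff d := (0 < d)%N && `[< exists b, wk b a a /\ wk (b + d) a a >].
have exd : exists d, diff d.
  case: closed_walk => k k0 kk; exists k; rewrite /diff k0; apply/asboolP.
  by exists 0%N; rewrite walk_of_length0 eqxx add0n.
case: (ex_minnP exd) => d /andP[d0 /asboolP[b [bL bdL]]] dmin.
have dL k : wk k a a -> (d %| k)%N.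
  move=> kL; rewrite /dvdn; apply/negPn/negP; rewrite -lt0n => r0.
  have : diff (k %% d)%N.
    (* With q = k / d, the closed walks of lengths q (b + d) and k + q b differ by k mod d, which
       would be a smaller positive difference. *)
    rewrite /diff r0; apply/asboolP; exists ((k %/ d) * (b + d))%N.
    split; first exact: closed_walk_mul.
    have -> : ((k %/ d) * (b + d) + k %% d = k + (k %/ d) * b)%N.
      by rewrite mulnDr -addnA -divn_eq addnC.
    by apply: walk_of_length_cat kL (closed_walk_mul _ bL).
  by move/dmin; rewrite leqNgt ltn_pmod.
have [j jp aj] := cyclic_classes_cover clP (mem_scc D a).
have pL k : wk k a a -> (p %| k)%N by apply: (cyclic_classes_dvdn clP jp aj aj).
have pd : (p %| d)%N by rewrite -(dvdn_addr d (pL _ bL)) pL.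
have dp : (d <= p)%N.
  apply: pmax; exists (fun j => [set w in S | `[< exists2 k, wk k a w & k = j %[mod d] >]]).
  have uniqmod w k k' : w \in S -> wk k a w -> wk k' a w -> k = k' %[mod d].
    rewrite inE => /andP[_ /walkP[l wl]] kw kw'.
    have := dL _ (walk_of_length_cat kw wl); have := dL _ (walk_of_length_cat kw' wl).
    rewrite /dvdn => /eqP E1 /eqP E2; apply/eqP; rewrite -(eqn_modDr l).
    by rewrite E1 E2.
  split=> //.
  - apply/setP=> w; apply/bigcupP/idP => [[i _]|wS]; first by rewrite inE => /andP[].
    have := wS; rewrite inE => /andP[/walkP[k kw] _].
    exists (Ordinal (ltn_pmod k d0)) => //; rewrite inE wS; apply/asboolP.
    by exists k => //=; rewrite modn_mod.
  (* A closed walk of positive length has length at least [d], and its vertex after [i] steps lies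
     in class [i]. *)
  - move=> i id'; apply/set0Pn.
    case: closed_walk => k k0 kk; have ik : (i <= k)%N.
      by apply: leq_trans (ltnW id') (dvdn_leq k0 (dL _ kk)).
    move: kk; rewrite -(subnKC ik) => /walk_of_lengthP[w iw wa].
    exists w; rewrite inE inE (walk_of_length_walk iw) (walk_of_length_walk wa).
    by apply/asboolP; exists i.
  - move=> i l id' ld' il; rewrite disjoints_subset; apply/subsetP=> w; rewrite !inE.
    case/andP=> wS /asboolP[k kw ki]; apply/negP => /andP[_ /asboolP[k' kw' kl]].
    apply: il; rewrite -(modn_small id') -(modn_small ld') -ki -kl.
    by apply: (uniqmod w); rewrite // inE.
  - move=> u v uS vS uv i id'; rewrite inE => /andP[_ /asboolP[k ku ki]].
    rewrite inE vS; apply/asboolP; exists (k + 1)%N.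
      by apply: walk_of_length_cat ku _; rewrite walk_of_length1.
    by rewrite modn_mod -(addn1 i) -[LHS]modnDml ki modnDml.
have dEp : d = p by apply/eqP; rewrite eqn_leq dp (dvdn_leq d0 pd).
exists (b %/ p)%N; rewrite mulnS !(mulnC p) divnK ?pL //.
by rewrite addnC -dEp.
Qed.

(** Closed walks at [a] of lengths p b and p (b + 1) combine to all lengths p m with m >= b^2. Any
    two vertices of a class are then joined through [a]. *)
Lemma period_primitive p cl : is_period D S p -> cyclic_classes D S p cl ->
  exists N, forall m j u v, (N <= m)%N -> (j < p)%N -> u \in cl j -> v \in cl j ->
    wk (p * m) u v.
Proof.
move=> pper clP; have [b [bL bL']] := period_difference pper.
have p0 : (0 < p)%N by case: clP.
have big m : (b * b <= m)%N -> wk (p * m) a a.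
  move=> bm; have [b0|b0] := posnP b.
    by rewrite mulnC; apply: closed_walk_mul; rewrite b0 muln1 in bL'.
  (* This makes the coefficients in m = (m mod b) (b + 1) + (m / b - m mod b) b nonnegative. *)
  have rb : (m %% b <= m %/ b)%N.
    by rewrite ltnW // (leq_trans (ltn_pmod m b0)) // leq_divRL.
  have -> : (p * m = (m %% b) * (p * b.+1) + (m %/ b - m %% b) * (p * b))%N.
    rewrite [X in (_ + X)%N]mulnCA [X in (X + _)%N]mulnCA -mulnDr; congr (_ * _)%N.
    rewrite {1}(divn_eq m b) mulnS -addnA addnC; congr (_ + _)%N.
    by rewrite -mulnDl subnKC.
  by apply: walk_of_length_cat; apply: closed_walk_mul.
have one (uv : 'I_n * 'I_n) : exists N, forall m j, (N <= m)%N -> (j < p)%N ->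
    uv.1 \in cl j -> uv.2 \in cl j -> wk (p * m) uv.1 uv.2.
  case: uv => u v /=.
  have [/andP[uS vS]|nS] := boolP ((u \in S) && (v \in S)); last first.
    exists 0%N => m j _ jp uj vj; case/negP: nS.
    by rewrite !(cyclic_classes_sub clP jp).
  (* The detour from [u] to [a] to [v] has length k + l, divisible by [p] as both ends share a
     class; a closed walk at [a] fills up the rest. *)
  have /walkP[k ku] := scc_walk uS (mem_scc D a).
  have /walkP[l lv] := scc_walk (mem_scc D a) vS.
  exists (b * b + (k + l) %/ p)%N => m j Nm jp uj vj.
  have klp : (p %| k + l)%N.
    by apply: cyclic_classes_dvdn clP jp uj vj (walk_of_length_cat ku lv).
  have -> : (p * m = k + (p * (m - (k + l) %/ p) + l))%N.
    have klm : (k + l <= p * m)%N.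
      by rewrite -(divnK klp) mulnC leq_mul2l (leq_trans _ Nm) ?leq_addl ?orbT.
    by rewrite mulnBr [X in (_ - X)%N]mulnC divnK //; lia.
  apply: walk_of_length_cat ku _; apply: walk_of_length_cat lv; apply: big.
  by rewrite leq_subRL ?(leq_trans _ Nm) ?leq_addl // addnC.
have [N HN] := fin_all_exists one.
exists (\sum_uv N uv)%N => m j u v Nm; apply: (HN (u, v)).
by apply: leq_trans Nm; rewrite (bigD1 (u, v)) //= leq_addr.
Qed.

End Period.

(** * Perron vectors of components *)

Section Adjacency.
Variables (R : realType) (n : nat).
Implicit Types (D : digraph n).

Lemma adjmx_exp D k : adjmx R D ^+ k = adjmx R (D ^+ k).
Proof.
elim: k => [|k IH]; first by apply/matrixP=> i j; rewrite !mxE; case: eqP.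
rewrite !exprS IH -!mulmxE; apply/matrixP=> i j; rewrite !mxE natr_sum.
by apply: eq_bigr => l _; rewrite !mxE natrM.
Qed.

Lemma adjmx_exp_ge0 D k i j : 0 <= (adjmx R D ^+ k) i j.
Proof. by rewrite adjmx_exp mxE ler0n. Qed.

Lemma adjmx_exp_gt0 D k i j :
  (0 < (adjmx R D ^+ k) i j) = walk_of_length D k i j.
Proof. by rewrite adjmx_exp mxE ltr0n. Qed.

Lemma adjmx_exp_neq0 D k i j :
  ((adjmx R D ^+ k) i j != 0) = walk_of_length D k i j.
Proof. by rewrite -adjmx_exp_gt0 lt_def adjmx_exp_ge0 andbT. Qed.

Lemma adjmx_tr D : adjmx R (trmx D : digraph n) = (adjmx R D)^T.
Proof. by apply/matrixP=> i j; rewrite !mxE. Qed.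

Lemma exp_mx_le (Q B : 'M[R[i]]_n) k i j :
  (forall i j, 0 <= Q i j <= B i j) -> 0 <= (Q ^+ k) i j <= (B ^+ k) i j.
Proof.
move=> QB; elim: k i j => [|k IH] i j; first by rewrite lexx andbT mxE; case: eqP.
rewrite !exprS -!mulmxE !mxE; apply/andP; split.
  apply: sumr_ge0 => l _; rewrite mulr_ge0 //.
    by case/andP: (QB i l).
  by case/andP: (IH l j).
apply: ler_sum => l _; case/andP: (QB i l) => q0 qb; case/andP: (IH l j) => k0 kb.
exact: ler_pM.
Qed.

End Adjacency.

(** * Spectral radius and positive eigenvectors *)

Section SpectralRadius.
Variable R : realType.

Lemma norm_eigenvalue_le n (M : 'M[R[i]]_n) (a : R[i]) :
  root (char_poly M) a -> `|a| <= (spectral_radius M)%:C.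
Proof.
move=> ra; rewrite -eigenvalue_root_char in ra.
rewrite -(RRe_real (normr_real a)) lecR; apply: ub_le_sup; last first.
  by exists a; rewrite ?(RRe_real (normr_real a)).
have [rs E] := char_poly_split M.
(* The sum of the moduli of all eigenvalues is a crude upper bound, needed for the supremum to be
   meaningful. *)
exists (complex.Re (\sum_(b <- rs) `|b|)) => x [b].
rewrite eigenvalue_root_char E root_prod_XsubC => brs Hb.
rewrite -lecR RRe_real ?ger0_real ?sumr_ge0 // -Hb.
by rewrite (big_rem b) //= lerDl sumr_ge0.
Qed.

(** The vector [v] makes [r] an eigenvalue in the row-vector sense. For any other left eigenvector y
    with eigenvalue a, pairing with [u] gives |a| |y| u <= |y| M u = r |y| u, where |y| u > 0. *)
Lemma spectral_radius_perron n (M : 'M[R[i]]_n) (r : R[i]) (u : 'cV[R[i]]_n)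
    (v : 'rV[R[i]]_n) : (0 < n)%N -> (forall i j, 0 <= M i j) -> 0 <= r ->
    (forall i, 0 < u i 0) -> M *m u = r *: u -> v != 0 -> v *m M = r *: v ->
  (spectral_radius M)%:C = r.
Proof.
move=> n0 M0 r0 u0 Mu v0 vM.
have evr : eigenvalue M r by apply/eigenvalueP; exists v.
apply/eqP; rewrite eq_le; apply/andP; split; last first.
  by rewrite -{1}(ger0_norm r0) norm_eigenvalue_le // -eigenvalue_root_char.
rewrite -(RRe_real (ger0_real r0)) lecR; apply: ge_sup.
  by exists (complex.Re r), r; rewrite // RRe_real ?ger0_real // ger0_norm.
move=> x [a /eigenvalueP[y yM y0] ax].
rewrite -lecR -ax RRe_real ?ger0_real //.
have S0 : 0 < \sum_i `|y 0 i| * u i 0.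
  case/rV0Pn: y0 => i yi; rewrite (bigD1 i) //= ltr_wpDr //.
    by apply: sumr_ge0 => j _; rewrite mulr_ge0 // ltW.
  by rewrite mulr_gt0 // normr_gt0.
rewrite -(ler_pM2r S0) !mulr_sumr.
apply: le_trans (_ : \sum_j (\sum_i `|y 0 i| * M i j) * u j 0 <= _).
  apply: ler_sum => j _; rewrite mulrA ler_wpM2r ?(ltW (u0 j)) //.
  have := congr1 (fun z : 'rV_n => `|z 0 j|) yM.
  rewrite !mxE normrM => <-; apply: le_trans (ler_norm_sum _ _ _) _.
  by apply: ler_sum => i _; rewrite normrM (ger0_norm (M0 _ _)).
under eq_bigr do rewrite mulr_suml.
rewrite exchange_big /= ler_sum // => i _.
have := congr1 (fun z : 'cV_n => z i 0) Mu; rewrite !mxE => E.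
by rewrite mulrCA -E mulr_sumr ler_sum // => j _; rewrite mulrA.
Qed.

End SpectralRadius.

Section Perron.
Variables (R : realType) (n : nat).
Implicit Types (D : digraph n).

(** The vector is extended by zero, and the eigenvalue equation is required only on [S], because A u
    may be nonzero at vertices outside [S] with arcs into it. *)
Definition perron_vec D (S : {set 'I_n}) (r : R[i]) (u : 'cV[R[i]]_n) : Prop :=
  [/\ forall w, w \in S -> 0 < u w 0, forall w, w \notin S -> u w 0 = 0 &
      forall w, w \in S -> (adjmx R D *m u) w 0 = r * u w 0].

Lemma perron_vec_extend D (S : {set 'I_n}) a (r : R[i]) (u : 'cV[R[i]]_#|S|) :
    a \in S -> (forall x, 0 < u x 0) -> adjmx R (induced D S) *m u = r *: u ->
  exists u', perron_vec D S r u'.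
Proof.
move=> aS u0 Iu.
exists (\col_w if w \in S then u (enum_rank_in aS w) 0 else 0).
split=> w wS; rewrite ?mxE ?wS ?(negPf wS) //.
have := congr1 (fun z : 'cV_ _ => z (enum_rank_in aS w) 0) Iu; rewrite !mxE => <-.
rewrite (bigID (mem S)) /= [X in _ + X]big1 ?addr0; last first.
  by move=> z /negPf zS; rewrite !mxE zS mulr0.
rewrite big_enum_val /=; apply: eq_bigr => x _.
by rewrite !mxE enum_valP enum_valK_in enum_rankK_in.
Qed.

Lemma perron_induced D (S : {set 'I_n}) a : S = scc D a ->
  exists (r : R[i]) (u : 'cV[R[i]]_#|S|),
    [/\ 0 <= r, forall x, 0 < u x 0 & adjmx R (induced D S) *m u = r *: u].
Proof.
move=> ->.
have : forall x y, exists k, 0 < (adjmx R (induced D (scc D a)) ^+ k) x y.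
  move=> x y; have /walkP[k kxy] := walk_scc_induced x y.
  by exists k; rewrite adjmx_exp_gt0.
have : forall x y, 0 <= adjmx R (induced D (scc D a)) x y.
  by move=> x y; rewrite mxE ler0n.
(* The cardinality is generalized because [perron_col] is stated for successor dimensions. *)
move: (adjmx _ _); have : (0 < #|scc D a|)%N by apply/card_gt0P; exists a; apply: mem_scc.
case: #|_| => // m _ M; exact: perron_col.
Qed.

Lemma scc_perron D a : exists (r : R[i]) (u v : 'cV[R[i]]_n),
  [/\ 0 <= r, perron_vec D (scc D a) r u,
      perron_vec (trmx D : digraph n) (scc D a) r v
    & (spectral_radius (adjmx R (induced D (scc D a))))%:C = r].
Proof.
have [r [u [r0 u0 Iu]]] := perron_induced (erefl (scc D a)).
have [r' [v [r0' v0 Iv]]] := perron_induced (esym (scc_tr D a)).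
have x0 := enum_rank_in (mem_scc D a) a.
have vI : v^T *m adjmx R (induced D (scc D a)) = r' *: v^T.
  rewrite -linearZ /= -Iv trmx_mul; congr (_ *m _).
  by apply/matrixP=> i j; rewrite !mxE.
(* Evaluating v^T M u in two ways equates the eigenvalues, since v^T u is positive. *)
have rr' : r' = r.
  have : r' *: (v^T *m u) = r *: (v^T *m u).
    by rewrite scalemxAl -vI -mulmxA Iu -scalemxAr.
  move/(congr1 (fun z : 'M_1 => z 0 0)); rewrite !mxE.
  apply: mulIf; rewrite gt_eqF // (bigD1 x0) //= ltr_wpDr //.
    by apply: sumr_ge0 => i _; rewrite mxE mulr_ge0 // ltW.
  by rewrite mxE mulr_gt0.
rewrite rr' in vI Iv.
have [u' Hu'] := perron_vec_extend (mem_scc D a) u0 Iu.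
have [v' Hv'] := perron_vec_extend (mem_scc D a) v0 Iv.
exists r, u', v'; split=> //.
apply: spectral_radius_perron u0 Iu _ vI => //.
- by apply/card_gt0P; exists a; apply: mem_scc.
- by move=> x y; rewrite mxE ler0n.
by apply/rV0Pn; exists x0; rewrite mxE gt_eqF.
Qed.

(** The equation iterates although it holds on the component only: by convexity, a vertex outside
    that is reached from the component has no arc back into it, so A u vanishes there. *)
Lemma perron_vec_pow D a (r : R[i]) u k w : perron_vec D (scc D a) r u ->
  w \in scc D a -> (adjmx R D ^+ k *m u) w 0 = r ^+ k * u w 0.
Proof.
move=> [u0 uz Au] wS; elim: k => [|k IH]; first by rewrite mul1mx mul1r.
rewrite exprSr -mulmxE -mulmxA exprS -mulrA -IH !mxE mulr_sumr.
apply: eq_bigr => z _; rewrite mulrCA.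
have [zS|zS] := boolP (z \in scc D a); first by rewrite Au.
rewrite (uz z zS) !mulr0; apply/eqP; rewrite mulf_eq0 -[X in X || _]negbK adjmx_exp_neq0.
apply/orP; have [wz|] := boolP (walk_of_length D k w z); [right|by left].
rewrite mxE big1 // => x _; have [xS|xS] := boolP (x \in scc D a); last by rewrite uz ?mulr0.
have [|zx] := eqVneq (adjmx R D z x) 0; first by move=> ->; rewrite mul0r.
case/negP: zS; apply: scc_convex wS xS (walk_of_length_walk wz) _.
by apply: (@walk_of_length_walk _ _ 1); rewrite -(adjmx_exp_neq0 R) expr1.
Qed.

(** Extended by zero, the Perron vector of a component is subinvariant for the whole matrix. *)
Lemma perron_le D a r u : perron_vec D (scc D a) r u -> 0 <= r ->
  r <= (spectral_radius (adjmx R D))%:C.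
Proof.
move=> [u0 uz Au] r0.
have Age i j : 0 <= adjmx R D i j by rewrite mxE ler0n.
have uge i : 0 <= u i 0.
  by have [/u0/ltW|/uz->] := boolP (i \in scc D a).
(* [subinvariant_eigenvalue] wants a positive constant; for r = 0 any eigenvalue will do. *)
have [r00|rn0] := eqVneq r 0.
  rewrite r00; have [|l rl] := closed_rootP (char_poly (adjmx R D)) _.
    by rewrite size_char_poly; case: (n) a {u0 uz Au} => [[]|].
  exact: le_trans (normr_ge0 l) (norm_eigenvalue_le rl).
have [||a' ra' /le_trans] := @subinvariant_eigenvalue _ _ (adjmx R D) u r a Age uge (u0 _ (mem_scc D a)).
- by rewrite lt_def rn0.
- move=> i; have [/Au->//|/uz->] := boolP (i \in scc D a).
  by rewrite mulr0 mxE sumr_ge0 // => j _; rewrite mulr_ge0.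
by apply; apply: norm_eigenvalue_le.
Qed.

End Perron.

(** * Eigenvectors of the masks *)

Section Dominant.
Variables (R : realType) (n : nat).
Implicit Types (D : digraph n) (rho : R[i]).

(* T is the union of the components of spectral radius rho, all others having a
   smaller one, and no component in T reaches another one.  The notion is
   invariant under reversal of all arcs, which turns right eigenvectors into
   left ones. *)
Definition dominant D rho (T : {set 'I_n}) : Prop :=
  (forall a, exists (r : R[i]) (u v : 'cV[R[i]]_n),
     [/\ 0 <= r <= rho, perron_vec D (scc D a) r u,
         perron_vec (trmx D : digraph n) (scc D a) r v
       & (a \in T) = (r == rho)]) /\
  (forall a b, a \in T -> b \in T -> walk D a b -> walk D b a).

Lemma dominant_tr D rho T :
  dominant D rho T -> dominant (trmx D : digraph n) rho T.
Proof.
move=> [H1 H2]; split=> [a|a b aT bT]; last by rewrite !walk_tr; apply: H2.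
have [r [u [v [r0 Hu Hv aT]]]] := H1 a; exists r, v, u.
by rewrite scc_tr trmxK.
Qed.

(** With v the left Perron vector of the component of [a] and r its eigenvalue, |mu| v|y| <= v A^k
    |y| = r^k v|y| <= rho^k v|y|. The lower bound on |mu| turns every inequality into an
    equality. *)
Lemma dominant_eigenvector D rho T k (Q : 'M[R[i]]_n) (mu : R[i])
    (y : 'cV[R[i]]_n) :
    dominant D rho T -> 0 < rho -> (0 < k)%N -> (forall i j, 0 <= Q i j) ->
    (forall i j, Q i j <= (adjmx R D ^+ k) i j) ->
    y != 0 -> Q *m y = mu *: y -> rho ^+ k <= `|mu| ->
  exists a, [/\ y a 0 != 0, a \in T,
    forall w, walk D a w -> ~~ walk D w a -> y w 0 = 0, `|mu| = rho ^+ k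
    & forall w, w \in scc D a ->
        rho ^+ k * `|y w 0| = \sum_z (adjmx R D ^+ k) w z * `|y z 0|].
Proof.
move=> [dom _] rho0 k0 Q0 QA y0 Qy mu_ge.
have [i0 yi0] : exists i, y i 0 != 0 by apply/cV0Pn.
(* A support vertex strictly beyond [a] would reach fewer vertices than [a] does. *)
case: (@arg_minnP _ i0 (fun i => y i 0 != 0) (fun i => #|[set w | walk D i w]|) yi0) => a ya amin.
have past w : walk D a w -> ~~ walk D w a -> y w 0 = 0.
  move=> aw wa; apply/eqP/negPn/negP => /amin; rewrite leqNgt => /negP; apply.
  apply: proper_card; apply/properP; split.
    by apply/subsetP=> z; rewrite !inE; apply: walk_trans.
  by exists a; rewrite !inE ?walk_refl.
have [r [u [v [/andP[r0 rrho] _ Pv aT]]]] := dom a.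
have [v0 vz _] := Pv.
set B := adjmx R D ^+ k in QA *.
pose L w := \sum_z B w z * `|y z 0|.
have B0 i j : 0 <= B i j by apply: adjmx_exp_ge0.
have muL w : `|mu| * `|y w 0| <= L w.
  have := congr1 (fun z : 'cV_n => `|z w 0|) Qy; rewrite !mxE normrM => <-.
  apply: le_trans (ler_norm_sum _ _ _) _; apply: ler_sum => z _.
  by rewrite normrM ler_wpM2r // ger0_norm.
have vge w : 0 <= v w 0.
  by have [/v0/ltW|/vz->] := boolP (w \in scc D a).
(* The left Perron equation holds on the component only, but a vertex outside it reached from it
   lies strictly beyond [a], where [y] vanishes. *)
have vL : \sum_w v w 0 * L w = r ^+ k * \sum_w v w 0 * `|y w 0|.
  under eq_bigr do rewrite mulr_sumr.
  rewrite exchange_big mulr_sumr /=; apply: eq_bigr => z _.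
  have [zS|zS] := boolP (z \in scc D a).
    rewrite mulrA -(perron_vec_pow (D := trmx D) (a := a)) ?scc_tr //.
    rewrite mxE mulr_suml; apply: eq_bigr => w _.
    by rewrite adjmx_tr -trmx_exp mxE mulrA -/B [B _ _ * _]mulrC.
  rewrite (vz z zS) mul0r mulr0 big1 // => w _.
  have [wS|/vz->] := boolP (w \in scc D a); last by rewrite mul0r.
  have [->|] := eqVneq (B w z) 0; first by rewrite mul0r mulr0.
  rewrite /B adjmx_exp_neq0 => /walk_of_length_walk wz.
  have aw := scc_walk (mem_scc D a) wS.
  rewrite past ?normr0 ?mulr0 //; first exact: walk_trans aw wz.
  by apply: contra zS => za; rewrite inE za (walk_trans aw wz).
set E := \sum_w v w 0 * `|y w 0| in vL.
have E0 : 0 < E.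
  rewrite /E (bigD1 a) //= ltr_wpDr //.
    by apply: sumr_ge0 => w _; rewrite mulr_ge0.
  by rewrite mulr_gt0 ?normr_gt0 // v0 // mem_scc.
have muE : \sum_w v w 0 * (`|mu| * `|y w 0|) = `|mu| * E.
  by rewrite mulr_sumr; apply: eq_bigr => w _; rewrite mulrCA.
have mur : `|mu| <= r ^+ k.
  rewrite -(ler_pM2r E0) -vL -muE; apply: ler_sum => w _.
  by rewrite ler_wpM2l.
have rk : r ^+ k <= rho ^+ k by apply: lerXn2r; rewrite ?nnegrE // ltW.
have muk : `|mu| = rho ^+ k.
  by apply/eqP; rewrite eq_le mu_ge andbT (le_trans mur).
have rEk : r ^+ k = rho ^+ k.
  by apply/eqP; rewrite eq_le rk -muk.
have rE : r = rho by apply: (pexpIrn k0); rewrite ?nnegrE // ltW.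
exists a; split=> //; first by rewrite aT rE.
move=> w wS; rewrite -muk; apply/eqP; rewrite eq_sym -subr_eq0.
(* The nonnegative gaps, weighted by [v], sum to zero, and [v] is positive on the component. *)
have : v w 0 * (L w - `|mu| * `|y w 0|) = 0.
  have nn z : true -> 0 <= v z 0 * (L z - `|mu| * `|y z 0|).
    by move=> _; rewrite mulr_ge0 // subr_ge0.
  have := @psumr_eq0P _ _ xpredT _ nn; apply=> //.
  under eq_bigr do rewrite mulrBr.
  by rewrite sumrB vL muE muk rEk subrr.
by move/eqP; rewrite mulf_eq0 gt_eqF // v0.
Qed.

End Dominant.

Section Cells.
Variables (R : realType) (n : nat).
Implicit Types (D : digraph n) (rho : R[i]) (W T : {set 'I_n}).

(** An abstraction of a periodic class. Reversing the arcs exchanges the two closure conditions, so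
    results on right eigenvectors transfer to left ones. *)
Definition cell D T p W N : Prop :=
  [/\ W \subset T, (0 < N)%N,
    forall u w, u \in W -> walk (D ^+ p) u w -> walk D w u -> w \in W,
    forall u w, u \in W -> walk (D ^+ p) w u -> walk D u w -> w \in W
  & forall u w, u \in W -> w \in W -> walk_of_length D (p * N) u w].

Lemma walk_pow_tr D p u v :
  walk ((trmx D : digraph n) ^+ p) u v = walk (D ^+ p) v u.
Proof. by rewrite -trmx_exp walk_tr. Qed.

Lemma cell_tr D T p W N : cell D T p W N -> cell (trmx D : digraph n) T p W N.
Proof.
move=> [WT N0 H1 H2 H3]; split=> // u w uW.
- by rewrite walk_pow_tr walk_tr; apply: H2.
- by rewrite walk_pow_tr walk_tr; apply: H1.
by move=> wW; rewrite walk_of_length_tr; apply: H3.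
Qed.

Lemma reach_set_tr D p W :
  reach_set ((trmx D : digraph n) ^+ p) W = reach_set (D ^+ p) W.
Proof.
apply/setP=> w; rewrite !inE; apply: eq_existsb => u.
by rewrite !walk_pow_tr orbC.
Qed.

Lemma set_mask_tr (V : {set 'I_n}) (M : 'M[R[i]]_n) :
  (set_mask V M)^T = set_mask V M^T.
Proof. by apply/matrixP=> i j; rewrite !mxE andbC. Qed.

Section RightEigenvector.
Variables (D : digraph n) (rho : R[i]) (T W : {set 'I_n}) (p N : nat).
Hypotheses (domT : dominant D rho T) (rho0 : 0 < rho) (p0 : (0 < p)%N).
Hypothesis cellW : cell D T p W N.
Local Notation A := (adjmx R D).
Local Notation V := (reach_set (D ^+ p) W).
Variable y : 'cV[R[i]]_n.
Hypotheses (y0 : y != 0) (My : set_mask V (A ^+ p) *m y = rho ^+ p *: y).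

Lemma mask_eigenvector_support w : y w 0 != 0 -> w \in V.
Proof.
apply: contraNT => wV; have := congr1 (fun z : 'cV_n => z w 0) My.
rewrite !mxE big1 => [/eqP|z _]; last by rewrite mxE (negPf wV) mul0r.
by rewrite eq_sym mulf_eq0 expf_eq0 (gt_eqF rho0) andbF.
Qed.

(** The vertex given by [dominant_eigenvector] lies in [T] and is joined to [W] by a walk of D^p.
    Separation in [T] puts it in the same component, and closure puts it in [W]. *)
Lemma mask_eigenvector_cell : exists a, [/\ y a 0 != 0, a \in W &
  forall w, walk D a w -> ~~ walk D w a -> y w 0 = 0].
Proof.
have [WT _ cl1 cl2 _] := cellW; have [_ sep] := domT.
have [|||a [ya aT past _ _]] := dominant_eigenvector domT rho0 p0 _ _ y0 My.
- by move=> i j; rewrite mxE; case: ifP => // _; apply: adjmx_exp_ge0.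
- by move=> i j; rewrite mxE; case: ifP => // _; apply: adjmx_exp_ge0.
- by rewrite ger0_norm // exprn_ge0 // ltW.
exists a; split=> //; have := mask_eigenvector_support ya.
rewrite inE => /existsP[u /andP[uW /orP[au|ua]]].
  by apply: (cl2 u) => //; apply: sep (walk_pow_walk au) => //; apply: (subsetP WT).
by apply: (cl1 u) => //; apply: sep (walk_pow_walk ua) => //; apply: (subsetP WT).
Qed.

(** A vertex of [V] lies before or after [W]; strictly after [W] the eigenvector vanishes. *)
Lemma mask_eigenvector_past w : y w 0 != 0 ->
  exists2 u, u \in W & walk (D ^+ p) w u.
Proof.
move=> yw; have [WT _ cl1 _ con] := cellW.
have [a [ya aW past]] := mask_eigenvector_cell.
have := mask_eigenvector_support yw.
rewrite inE => /existsP[u /andP[uW /orP[wu|uw]]]; first by exists u.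
exists w; last exact: walk_refl.
apply: (cl1 u) => //; have uw' := walk_pow_walk uw.
apply: contraNT yw => wu; apply/eqP; apply: past.
  by apply: walk_trans uw'; apply: walk_of_length_walk (con _ _ aW uW).
by apply: contra wu => wa; apply: walk_trans wa (walk_of_length_walk (con _ _ aW uW)).
Qed.

(** The support of [y] leads into [W] along D^p, so every predecessor in D^p of a support vertex is
    already in [V] and masking loses nothing. *)
Lemma mask_eigenvector_full : A ^+ p *m y = rho ^+ p *: y.
Proof.
rewrite -My; apply/matrixP=> w j; rewrite ord1 !mxE; apply: eq_bigr => z _.
rewrite !mxE; have [->|yz] := eqVneq (y z 0) 0; first by rewrite !mulr0.
rewrite (mask_eigenvector_support yz) andbT; case: ifP => // /negP wV.
have [->//|Awz] := eqVneq ((A ^+ p) w z) 0; case: wV.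
have [u uW zu] := mask_eigenvector_past yz.
rewrite inE; apply/existsP; exists u; rewrite uW; apply/orP; left.
apply: walk_trans zu; apply/walk_powP; exists 1%N.
by rewrite muln1 -(adjmx_exp_neq0 R).
Qed.

Lemma mask_eigenvector_proportional w0 u :
    w0 \in W -> perron_vec D (scc D w0) rho u ->
  exists2 c, c != 0 & forall w, w \in W -> y w 0 = c * u w 0.
Proof.
move=> w0W Pu; have [u0 uz _] := Pu; have [WT N0 cl1 cl2 con] := cellW.
have WS w : w \in W -> w \in scc D w0.
  by move=> wW; rewrite inE !(walk_of_length_walk (con _ _ _ _)).
(* Chosen so that [z] vanishes at [w0]; the aim is z = 0. *)
set c := y w0 0 / u w0 0.
pose z : 'cV[R[i]]_n := \col_w if w \in W then y w 0 - c * u w 0 else 0.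
set Q := set_mask W (A ^+ p).
(* A D^p-successor of [W] outside [W] is outside the component and cannot lead back to [W], so [u]
   and [y] both vanish there. *)
have Qz : Q *m z = rho ^+ p *: z.
  apply/matrixP=> w j; rewrite ord1 [RHS]mxE [z w 0]mxE [LHS]mxE.
  have [wW|wW] := boolP (w \in W); last first.
    by rewrite mulr0 big1 // => x _; rewrite mxE (negPf wW) mul0r.
  have := congr1 (fun z : 'cV_n => z w 0) mask_eigenvector_full.
  rewrite mxE [in RHS]mxE => Ay.
  have := perron_vec_pow p Pu (WS _ wW); rewrite mxE => Au.
  rewrite mulrBr mulrCA -Ay -Au mulr_sumr -sumrB; apply: eq_bigr => x _.
  rewrite !mxE wW /=; have [xW|xW] := boolP (x \in W); first by rewrite mulrBr mulrCA.
  rewrite mul0r; have [->|] := eqVneq ((A ^+ p) w x) 0; first by rewrite !mul0r mulr0 subrr.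
  rewrite adjmx_exp_neq0 => wx.
  have wx' : walk (D ^+ p) w x by apply/walk_powP; exists 1%N; rewrite muln1.
  rewrite uz ?mulr0 ?subr0; last first.
    apply: contra xW => xS; apply: (cl1 w) => //.
    exact: scc_walk xS (WS _ wW).
  suff -> : y x 0 = 0 by rewrite mulr0.
  apply: contraNeq xW => /mask_eigenvector_past[t tW xt].
  apply: (cl1 w) => //; apply: walk_trans (walk_pow_walk xt) _.
  exact: walk_of_length_walk (con _ _ tW wW).
have Qzk k : Q ^+ k *m z = (rho ^+ p) ^+ k *: z.
  elim: k => [|k IH]; first by rewrite mul1mx scale1r.
  by rewrite exprSr -mulmxE -mulmxA Qz -scalemxAr IH scalerA exprS.
have QB i j : 0 <= Q i j <= (A ^+ p) i j.
  by rewrite mxE; case: ifP => _; rewrite ?lexx adjmx_exp_ge0.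
have z0 : z = 0.
  apply/eqP/negPn/negP => zn0; have pN0 : (0 < p * N)%N by rewrite muln_gt0 p0.
  have [|||a [za _ _ _ eqS]] := dominant_eigenvector domT rho0 pN0 _ _ zn0 (Qzk N).
  - by move=> i j; case/andP: (exp_mx_le N i j QB).
  - by move=> i j; rewrite exprM; case/andP: (exp_mx_le N i j QB).
  - by rewrite -exprM ger0_norm // exprn_ge0 // ltW.
  have aW : a \in W by apply: contraNT za => aW; rewrite mxE (negPf aW).
  (* At [w0] the left side is zero, while A^(pN) is positive on [W] and [z] is nonzero at [a]. *)
  have := eqS w0; rewrite (sccE (WS _ aW)) mem_scc => /(_ isT).
  rewrite {1}/z mxE w0W /c divfK ?gt_eqF ?u0 ?mem_scc // subrr normr0 mulr0.
  move/esym/psumr_eq0P => H.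
  have /eqP := H (fun x _ => mulr_ge0 (adjmx_exp_ge0 R D _ _ _) (normr_ge0 _)) a isT.
  rewrite mulf_eq0 normr_eq0 (negPf za) orbF; apply/negP.
  by rewrite adjmx_exp_neq0 con.
have yE w : w \in W -> y w 0 = c * u w 0.
  move=> wW; apply/eqP; rewrite -subr_eq0; apply/eqP.
  by have := congr1 (fun z : 'cV_n => z w 0) z0; rewrite !mxE wW.
exists c => //; have [a [ya aW _]] := mask_eigenvector_cell.
by apply: contra_neq ya => c0; rewrite yE // c0 mul0r.
Qed.

End RightEigenvector.
End Cells.

(** * Asymptotics *)

(** [Pi] is a projection with B Pi = Pi B = Pi, so B^m - Pi = (B - Pi)^m for m > 0. An eigenvector
    of B - Pi with nonzero eigenvalue is annihilated by every [l x], hence is an eigenvector of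
    [B]. *)
Lemma fixed_space_decay (C : numClosedFieldType) n (B : 'M[C]_n) (I : finType)
    (l : I -> 'rV[C]_n) (r : I -> 'cV[C]_n) :
    (forall x, l x *m B = l x) -> (forall x, B *m r x = r x) ->
    (forall x y, l x *m r y = (x == y)%:R%:M) ->
    (forall a (y : 'cV[C]_n), y != 0 -> B *m y = a *: y ->
       (forall x, l x *m y = 0) -> `|a| < 1) ->
  exists c K : C, [/\ 0 < c, c < 1, 0 <= K &
    forall m i j, `|(B ^+ m - \sum_x r x *m l x) i j| <= K * c ^+ m].
Proof.
move=> lB Br lr small.
set Pi := \sum_x r x *m l x.
have lPi x : l x *m Pi = l x.
  rewrite mulmx_sumr (bigD1 x) //= mulmxA lr eqxx mul1mx big1 ?addr0 // => y yx.
  by rewrite mulmxA lr eq_sym (negPf yx) raddf0 mul0mx.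
have PiB : Pi *m B = Pi.
  by rewrite mulmx_suml; apply: eq_bigr => x _; rewrite -mulmxA lB.
have BPi : B *m Pi = Pi.
  by rewrite mulmx_sumr; apply: eq_bigr => x _; rewrite mulmxA Br.
have PiPi : Pi *m Pi = Pi.
  by rewrite {1}/Pi mulmx_suml; apply: eq_bigr => x _; rewrite -mulmxA lPi.
set N := B - Pi.
have BmPi m : B ^+ m *m Pi = Pi.
  by elim: m => [|m IH]; [rewrite mul1mx|rewrite exprSr -mulmxE -mulmxA BPi].
have Npow m : B ^+ m.+1 - Pi = N ^+ m.+1.
  elim: m => [|m IH]; first by rewrite !expr1.
  rewrite [RHS]exprSr -IH -mulmxE /N mulmxBl !mulmxBr BmPi PiB PiPi subrr subr0.
  by rewrite mulmxE -exprSr.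
have [a y y0 Ny|c [K [c0 c1 K0 HK]]] := @power_decay C n N.
  have ly x : a *: (l x *m y) = 0.
    by rewrite scalemxAr -Ny mulmxA mulmxBr lB lPi subrr mul0mx.
  have [->|a0] := eqVneq a 0; first by rewrite normr0.
  have ly0 x : l x *m y = 0.
    by have /eqP := ly x; rewrite scaler_eq0 (negPf a0) => /eqP.
  apply: (small a y) => //; rewrite -Ny /N mulmxBl [Pi *m y]mulmx_suml big1 ?subr0 // => x _.
  by rewrite -mulmxA ly0 mulmx0.
(* The extra sum covers m = 0, where 1 - Pi is not the zeroth power of [N]. *)
exists c, (K + \sum_i \sum_j `|(B ^+ 0 - Pi) i j|); split=> //.
  by rewrite addr_ge0 // sumr_ge0 // => i _; rewrite sumr_ge0.
move=> [|m] i j.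
  rewrite [c ^+ 0]expr0 mulr1; apply: ler_wpDl => //; rewrite (bigD1 i) //=.
  apply: ler_wpDr; first by apply: sumr_ge0 => u _; rewrite sumr_ge0.
  by rewrite (bigD1 j) //= lerDl sumr_ge0.
rewrite Npow (le_trans (HK m.+1 i j)) // ler_wpM2r ?exprn_ge0 ?(ltW c0) //.
by rewrite lerDl sumr_ge0 // => u _; rewrite sumr_ge0.
Qed.

(** * Class eigenvectors of the components of spectral radius [rho] *)

Section Main.
Variables (R : realType) (n : nat) (D : digraph n) (rho : R) (s t : nat).
Variables (K : nat -> {set 'I_n}) (p : nat -> nat) (cl : nat -> nat -> {set 'I_n}).
Variables (vL : nat -> nat -> 'rV[R[i]]_n) (vR : nat -> nat -> 'cV[R[i]]_n).
Local Notation A := (adjmx R D).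
Local Notation V i j := (reach_set (D ^+ p i) (cl i j)).
Hypothesis radA : spectral_radius A = rho.
Hypothesis rho0 : 0 < rho.
Hypothesis st : (s <= t)%N.
Hypothesis compK : forall S, component D S <-> exists2 i, (i < t)%N & K i = S.
Hypothesis topK : forall i, (i < t)%N ->
  (spectral_radius (adjmx R (induced D (K i))) = rho <-> (i < s)%N).
Hypothesis perK : forall i, (i < s)%N ->
  is_period D (K i) (p i) /\ cyclic_classes D (K i) (p i) (cl i).
Hypothesis eigK : forall i j, (i < s)%N -> (j < p i)%N ->
  [/\ left_eigenvector (set_mask (V i j) (A ^+ p i)) (rho%:C ^+ p i) (vL i j),
      right_eigenvector (set_mask (V i j) (A ^+ p i)) (rho%:C ^+ p i) (vR i j)
    & pairing (vL i j) (vR i j) = 1].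
Hypothesis sepK : forall a b, (a < s)%N -> (b < s)%N -> a <> b ->
  forall u v, u \in K a -> v \in K b -> ~~ walk D u v.

Let T : {set 'I_n} := [set w | [exists i : 'I_s, w \in K i]].

Let rhoC0 : 0 < rho%:C.
Proof. by rewrite ltcR. Qed.

Lemma top_component i a : (i < t)%N -> a \in K i -> K i = scc D a.
Proof. by move=> it aK; apply: componentE => //; apply/compK; exists i. Qed.

Lemma top_component_nonempty i : (i < s)%N -> exists2 a, a \in K i & K i = scc D a.
Proof.
move=> si; have it := leq_trans si st.
have [_ [p0 clK cl0 _ _]] := perK si.
have /set0Pn[a ac] := cl0 _ p0.
have aK : a \in K i by rewrite -clK; apply/bigcupP; exists (Ordinal p0).
by exists a => //; apply: top_component.
Qed.

Lemma mem_top a : reflect (exists2 i, (i < s)%N & a \in K i) (a \in T).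
Proof.
rewrite inE; apply: (iffP existsP) => [[i ai]|[i si ai]]; first by exists i.
by exists (Ordinal si).
Qed.

Lemma top_dominant : dominant D rho%:C T.
Proof.
split=> [a|a b /mem_top[i si ai] /mem_top[j sj bj] ab].
  have [r [u [v [r0 Pu Pv rE]]]] := scc_perron R D a.
  exists r, u, v; split=> //.
    by rewrite r0 -radA; apply: perron_le Pu r0.
  have [i it Ki] := (compK (scc D a)).1 (component_scc D a).
  apply/mem_top/eqP => [[j sj aj]|rr].
    have jt := leq_trans sj st.
    rewrite -rE -(top_component jt aj); congr _%:C.
    by apply/(topK jt).
  exists i; last by rewrite Ki mem_scc.
  by apply/(topK it); apply: complexI; rewrite Ki rE rr.
have [ij|/eqP ij] := eqVneq i j; last by have := sepK si sj ij ai bj; rewrite ab.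
rewrite -ij in bj; have Ki := top_component (leq_trans si st) ai.
by apply: (@scc_walk _ _ a); rewrite -Ki.
Qed.

Lemma top_perron i a : (i < s)%N -> a \in K i -> exists u v,
  perron_vec D (scc D a) rho%:C u /\ perron_vec (trmx D : digraph n) (scc D a) rho%:C v.
Proof.
move=> si ai; have [/(_ a)[r [u [v [_ Pu Pv aT]]]] _] := top_dominant.
have /eqP rE : r == rho%:C by rewrite -aT; apply/mem_top; exists i.
by exists u, v; rewrite -rE.
Qed.

(** As rho > 0, the Perron equation at [a] forces an arc from [a] into its component, and a walk
    leads back. *)
Lemma top_closed_walk i a : (i < s)%N -> a \in K i ->
  exists2 k, (0 < k)%N & walk_of_length D k a a.
Proof.
move=> si ai; have [u [v [[u0 uz Au] _]]] := top_perron si ai.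
have : (A *m u) a 0 != 0.
  by rewrite Au ?mem_scc // mulf_neq0 ?gt_eqF ?u0 ?mem_scc.
rewrite mxE => Sn; have [z zn] : exists z, A a z * u z 0 != 0.
  apply/existsP; apply: contraNT Sn; rewrite negb_exists => /forallP H.
  by rewrite big1 // => z _; apply/eqP; have := H z; rewrite negbK.
move: zn; rewrite mulf_eq0 negb_or => /andP[az uzn].
have zS : z \in scc D a by apply: contraNT uzn => /uz->.
have /walkP[k zk] := scc_walk zS (mem_scc D a).
exists (1 + k)%N => //; apply: walk_of_length_cat zk.
by rewrite -(adjmx_exp_neq0 R) expr1.
Qed.

Lemma top_primitive : exists2 N, (0 < N)%N & forall i m j u v, (i < s)%N ->
  (N <= m)%N -> (j < p i)%N -> u \in cl i j -> v \in cl i j ->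
  walk_of_length D (p i * m) u v.
Proof.
have one (i : 'I_s) : exists N, forall m j u v, (N <= m)%N -> (j < p i)%N ->
    u \in cl i j -> v \in cl i j -> walk_of_length D (p i * m) u v.
  have [a ai Ki] := top_component_nonempty (ltn_ord i).
  have [] := perK (ltn_ord i); rewrite Ki; apply: period_primitive.
  exact: top_closed_walk ai.
have [N HN] := fin_all_exists one.
exists (\sum_i N i).+1 => // i m j u v si Nm; apply: (HN (Ordinal si)).
by apply: leq_trans (ltnW Nm); rewrite (bigD1 (Ordinal si)) //= leq_addr.
Qed.

Lemma class_cell N i j :
    (forall i m j u v, (i < s)%N ->
      (N <= m)%N -> (j < p i)%N -> u \in cl i j -> v \in cl i j ->
      walk_of_length D (p i * m) u v) ->
    (0 < N)%N -> (i < s)%N -> (j < p i)%N ->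
  cell D T (p i) (cl i j) N.
Proof.
move=> HN N0 si jp; have [a ai Ki] := top_component_nonempty si.
have [_ clP] := perK si; rewrite Ki in clP.
have p0 : (0 < p i)%N by case: clP.
have sub w : w \in cl i j -> w \in scc D a by apply: (cyclic_classes_sub clP jp).
split=> //.
- by apply/subsetP=> w /sub wS; apply/mem_top; exists i; rewrite // Ki.
- move=> u w uW uw wu; have uS := sub _ uW.
  have wS := scc_convex uS uS (walk_pow_walk uw) wu.
  have /walk_powP[k uk] := uw.
  have := cyclic_classes_walk clP jp uW wS uk.
  by rewrite addnC mulnC modnMDl modn_small.
- move=> u w uW wu uw; have uS := sub _ uW.
  have wS := scc_convex uS uS uw (walk_pow_walk wu).
  have /walk_powP[k wk] := wu.
  have [j' jp' wj'] := cyclic_classes_cover clP wS.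
  have := cyclic_classes_walk clP jp' wj' uS wk.
  rewrite addnC mulnC modnMDl modn_small // => uj'.
  by rewrite (cyclic_classes_inj clP jp jp' uW uj').
by move=> u w uW wW; apply: HN wW.
Qed.

Lemma class_period_gt0 i : (i < s)%N -> (0 < p i)%N.
Proof. by move=> /perK[_ []]. Qed.

Lemma ex_class_cell i j : (i < s)%N -> (j < p i)%N ->
  exists N, cell D T (p i) (cl i j) N.
Proof.
by move=> si jp; have [N N0 HN] := top_primitive; exists N; apply: class_cell.
Qed.

Lemma tr_left_eigenvector (M : 'M[R[i]]_n) (a : R[i]) x :
  left_eigenvector M a x -> x^T != 0 /\ M^T *m x^T = a *: x^T.
Proof.
move=> [x0 xM]; split; first by rewrite -[0]trmx0 (inj_eq trmx_inj).
by rewrite -trmx_mul xM linearZ.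
Qed.

Lemma left_mask_tr i j x :
    left_eigenvector (set_mask (V i j) (A ^+ p i)) (rho%:C ^+ p i) x ->
  x^T != 0 /\ set_mask (reach_set ((trmx D : digraph n) ^+ p i) (cl i j))
     (adjmx R (trmx D : digraph n) ^+ p i) *m x^T = rho%:C ^+ p i *: x^T.
Proof.
move/tr_left_eigenvector; rewrite reach_set_tr adjmx_tr -trmx_exp.
by rewrite set_mask_tr.
Qed.

(** This is [mask_eigenvector_past] for the reversed digraph, where walks into the class become
    walks out of it. *)
Lemma vL_future i j w : (i < s)%N -> (j < p i)%N -> vL i j 0 w != 0 ->
  exists2 u, u \in cl i j & walk (D ^+ p i) u w.
Proof.
move=> si jp vw; have [N cellN] := ex_class_cell si jp.
have [/left_mask_tr[x0 Mx] _ _] := eigK si jp.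
have := mask_eigenvector_past (dominant_tr top_dominant) rhoC0
  (class_period_gt0 si) (cell_tr cellN) x0 Mx (w := w).
rewrite mxE => /(_ vw)[u uW uw]; exists u => //.
by rewrite -walk_pow_tr.
Qed.

Lemma vL_exp i j : (i < s)%N -> (j < p i)%N ->
  vL i j *m A ^+ p i = rho%:C ^+ p i *: vL i j.
Proof.
move=> si jp; have [N cellN] := ex_class_cell si jp.
have [/left_mask_tr[x0 Mx] _ _] := eigK si jp.
have := mask_eigenvector_full (dominant_tr top_dominant) rhoC0
  (class_period_gt0 si) (cell_tr cellN) x0 Mx.
rewrite adjmx_tr -trmx_exp -trmx_mul -linearZ /=; exact: trmx_inj.
Qed.

Lemma vR_past i j w : (i < s)%N -> (j < p i)%N -> vR i j w 0 != 0 ->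
  exists2 u, u \in cl i j & walk (D ^+ p i) w u.
Proof.
move=> si jp; have [N cellN] := ex_class_cell si jp.
have [_ [x0 Mx] _] := eigK si jp.
exact: (mask_eigenvector_past top_dominant rhoC0 (class_period_gt0 si) cellN x0 Mx).
Qed.

Lemma vR_exp i j : (i < s)%N -> (j < p i)%N ->
  A ^+ p i *m vR i j = rho%:C ^+ p i *: vR i j.
Proof.
move=> si jp; have [N cellN] := ex_class_cell si jp.
have [_ [x0 Mx] _] := eigK si jp.
exact: (mask_eigenvector_full top_dominant rhoC0 (class_period_gt0 si) cellN x0 Mx).
Qed.

Lemma vL_proportional i j a v : (i < s)%N -> (j < p i)%N -> a \in K i ->
    perron_vec (trmx D : digraph n) (scc D a) rho%:C v ->
  exists2 c, c != 0 & forall w, w \in cl i j -> vL i j 0 w = c * v w 0.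
Proof.
move=> si jp ai Pv; have [N cellN] := ex_class_cell si jp.
have [/left_mask_tr[x0 Mx] _ _] := eigK si jp.
have [_ clP] := perK si; have Ki := top_component (leq_trans si st) ai.
rewrite Ki in clP; have [_ _ /(_ _ jp)/set0Pn[w0 w0W] _ _] := clP.
have Sw0 := sccE (cyclic_classes_sub clP jp w0W).
rewrite -Sw0 -scc_tr in Pv.
have [c c0 Hc] := mask_eigenvector_proportional (dominant_tr top_dominant) rhoC0
  (class_period_gt0 si) (cell_tr cellN) x0 Mx w0W Pv.
by exists c => // w wW; rewrite -Hc // mxE.
Qed.

(** A nonzero term gives a walk from one class to the other. Separation forces i = i', and then its
    length is a multiple of [p i], which forces j = j'. *)
Lemma vL_vR_orthogonal i j i' j' : (i < s)%N -> (j < p i)%N ->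
    (i' < s)%N -> (j' < p i')%N -> (i, j) != (i', j') ->
  vL i j *m vR i' j' = 0.
Proof.
move=> si jp si' jp' ij; apply/matrixP=> x y; rewrite !ord1 !mxE big1 // => w _.
have [->|vLw] := eqVneq (vL i j 0 w) 0; first by rewrite mul0r.
have [->|vRw] := eqVneq (vR i' j' w 0) 0; first by rewrite mulr0.
have [u uW uw] := vL_future si jp vLw; have [u' uW' wu'] := vR_past si' jp' vRw.
have [_ clP] := perK si; have [_ clP'] := perK si'.
have uK : u \in K i by case: clP => _ <- _ _ _; apply/bigcupP; exists (Ordinal jp).
have uK' : u' \in K i' by case: clP' => _ <- _ _ _; apply/bigcupP; exists (Ordinal jp').
have uu' := walk_trans (walk_pow_walk uw) (walk_pow_walk wu').
have [ii'|/eqP ii'] := eqVneq i i'; last by have := sepK si si' ii' uK uK'; rewrite uu'.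
subst i'; case/negP: ij; rewrite xpair_eqE eqxx /=.
have Ki := top_component (leq_trans si st) uK; rewrite Ki in clP uK'.
have /walk_powP[k uk] := walk_trans uw wu'.
have := cyclic_classes_walk clP jp uW uK' uk.
rewrite addnC mulnC modnMDl modn_small // => uj'.
by rewrite (cyclic_classes_inj clP jp jp' uj' uW').
Qed.

Lemma mask_left_eigenvector (S : {set 'I_n}) (B : 'M[R[i]]_n) (a : R[i])
    (x : 'rV[R[i]]_n) :
  (forall w, x 0 w != 0 -> w \in S) -> x *m B = a *: x ->
  x *m set_mask S B = a *: x.
Proof.
move=> xS xB; apply/matrixP=> y w; rewrite ord1 [RHS]mxE.
have [wS|wS] := boolP (w \in S); last first.
  have -> : x 0 w = 0 by apply: contraNeq wS => /xS.
  by rewrite mulr0 mxE big1 // => z _; rewrite mxE (negPf wS) andbF mulr0.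
have := congr1 (fun z : 'rV_n => z 0 w) xB; rewrite [in RHS]mxE => <-.
rewrite !mxE; apply: eq_bigr => z _; rewrite mxE wS andbT.
have [->|/xS->//] := eqVneq (x 0 z) 0; by rewrite !mul0r.
Qed.

Lemma vL_next_support i j w : (i < s)%N -> (j < p i)%N ->
  (vL i j *m A) 0 w != 0 -> w \in V i (j.+1 %% p i)%N.
Proof.
move=> si jp; rewrite mxE => Sn.
have [z] : exists z, vL i j 0 z * A z w != 0.
  apply/existsP; apply: contraNT Sn; rewrite negb_exists => /forallP H.
  by rewrite big1 // => z _; apply/eqP; have := H z; rewrite negbK.
rewrite mulf_eq0 negb_or => /andP[vz zw].
have [u uW /walk_powP[k uz]] := vL_future si jp vz.
have [a ai Ki] := top_component_nonempty si.
have [_ clP] := perK si; rewrite Ki in clP.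
have p0 := class_period_gt0 si.
have jp' := ltn_pmod j.+1 p0.
have [_ _ /(_ _ jp')/set0Pn[u' uW'] _ _] := clP.
have uS := cyclic_classes_sub clP jp uW; have uS' := cyclic_classes_sub clP jp' uW'.
(* Going from class j + 1 to class j takes l steps with [p i] dividing l + 1; the arc from [z] to
   [w] supplies the missing step. *)
have /walkP[l ul] := scc_walk uS' uS.
have := cyclic_classes_walk clP jp' uW' uS ul.
move/(cyclic_classes_inj clP jp (ltn_pmod _ p0) uW) => /eqP.
rewrite modnDml -{1}(modn_small jp) addSnnS -[X in (X %% _)%N == _]addn0 eqn_modDl.
rewrite mod0n eq_sym => /dvdnP[q lq].
rewrite inE; apply/existsP; exists u'; rewrite uW'; apply/orP; right.
apply/walk_powP; exists (q + k)%N.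
have zw1 : walk_of_length D 1 z w by rewrite -(adjmx_exp_neq0 R) expr1.
have := walk_of_length_cat ul (walk_of_length_cat uz zw1).
by rewrite addnCA addn1 lq [(q * _)%N]mulnC -mulnDr addnC.
Qed.

(** Scale each vector to agree on its class with one common left Perron vector of the component. The
    defect of coherence is then zero on the next class, where a mask eigenvector cannot vanish. *)
Lemma coherent_rescaling i : (i < s)%N -> exists c : nat -> R[i],
  (forall j, (j < p i)%N -> c j != 0) /\
  coherent A rho (p i) (fun j => c j *: vL i j).
Proof.
move=> si; have p0 := class_period_gt0 si.
have [a ai Ki] := top_component_nonempty si.
have [_ clP] := perK si; rewrite Ki in clP.
have [u [v [_ Pv]]] := top_perron si ai.
have [c Hc] : exists c : 'I_(p i) -> R[i], forall j, c j != 0 /\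
    forall w, w \in cl i j -> vL i j 0 w = c j * v w 0.
  apply: (fin_all_exists (P := fun (j : 'I_(p i)) (c : R[i]) => c != 0 /\
    forall w, w \in cl i j -> vL i j 0 w = c * v w 0)) => j.
  by have [c c0 Hc] := vL_proportional si (ltn_ord j) ai Pv; exists c.
(* The value 1 is a dummy for indices out of range. *)
pose c' j := (if insub j is Some o then c o else 1)^-1.
have c'0 j : (j < p i)%N -> c' j != 0.
  by move=> jp; rewrite /c' insubT invr_eq0; case: (Hc (Sub j jp)).
have c'E j w : (j < p i)%N -> w \in cl i j -> c' j * vL i j 0 w = v w 0.
  move=> jp wj; have [c0 /(_ w wj) ->] := Hc (Ordinal jp).
  by rewrite /c' insubT mulKf.
exists c'; split=> // j jp; have jp' := ltn_pmod j.+1 p0.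
apply/eqP; rewrite -subr_eq0; apply/negPn/negP => x0.
set j' := (j.+1 %% p i)%N in jp' x0 *.
set x := _ - _ in x0.
have [N cellN] := ex_class_cell si jp'.
have xM : left_eigenvector (set_mask (V i j') (A ^+ p i)) (rho%:C ^+ p i) x.
  split=> //; rewrite mulmxBl scalerBr; congr (_ - _).
    rewrite -scalemxAl -scalemxAl [RHS]scalerA mulrC -scalerA; congr (_ *: _).
    apply: mask_left_eigenvector => [w|]; first exact: vL_next_support.
    by rewrite -mulmxA mulmxE -exprS exprSr -mulmxE mulmxA vL_exp // -scalemxAl.
  have [[_ vM] _ _] := eigK si jp'.
  by rewrite -!scalemxAl vM !scalerA; congr (_ *: _); rewrite [RHS]mulrC.
have [x0' Mx] := left_mask_tr xM.
have [w [xw wW _]] := mask_eigenvector_cell (dominant_tr top_dominant) rhoC0 p0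
  (cell_tr cellN) x0' Mx.
case/negP: xw; rewrite mxE /x; apply/eqP.
have wS := cyclic_classes_sub clP jp' wW.
have [_ _ clN _ _] := cellN.
have [_ vz Av] := Pv.
have := Av w wS; rewrite adjmx_tr [LHS]mxE => Avw.
rewrite [LHS]mxE [X in _ + X]mxE [X in - X]mxE [X in _ * X]mxE c'E // -Avw.
rewrite -scalemxAl mxE [X in _ * X]mxE mulr_sumr; apply/eqP; rewrite subr_eq0; apply/eqP.
apply: eq_bigr => z _; rewrite [A^T _ _]mxE.
have [->|zw] := eqVneq (A z w) 0; first by rewrite mul0r !mulr0.
rewrite mulrA [RHS]mulrC; congr (_ * _).
have zw1 : walk_of_length D 1 z w by rewrite -(adjmx_exp_neq0 R) expr1.
(* Predecessors of [w] inside the component lie in class [j], where the rescaled vector equals [v];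
   outside the component both vanish. *)
have zj : z \in scc D a -> z \in cl i j.
  move=> zS; have [l lp zl] := cyclic_classes_cover clP zS.
  have := cyclic_classes_walk clP lp zl wS zw1.
  move/(cyclic_classes_inj clP jp' (ltn_pmod _ p0) wW) => /eqP.
  by rewrite /j' -addn1 eqn_modDr !modn_small // => /eqP->.
have [/zj zj'|zS] := boolP (z \in scc D a); first by rewrite c'E.
rewrite vz //; apply/eqP; rewrite mulf_eq0 (negPf (c'0 _ jp)) /=.
apply: contraNT zS => vLz; have [y yW yz] := vL_future si jp vLz.
apply: scc_convex (cyclic_classes_sub clP jp yW) wS (walk_pow_walk yz) _.
exact: walk_of_length_walk zw1.
Qed.

Lemma vL_annihilated_small k (y : 'cV[R[i]]_n) (mu : R[i]) :
    (0 < k)%N -> (forall i, (i < s)%N -> (p i %| k)%N) ->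
    y != 0 -> A ^+ k *m y = mu *: y ->
    (forall i j, (i < s)%N -> (j < p i)%N -> vL i j *m y = 0) ->
  `|mu| < rho%:C ^+ k.
Proof.
move=> k0 pk y0 Ay vLy; have [N N0 HN] := top_primitive.
rewrite real_ltNge ?normr_real ?ger0_real ?exprn_ge0 ?(ltW rhoC0) //.
apply/negP => mu_ge.
have AN m : (A ^+ k) ^+ m *m y = mu ^+ m *: y.
  elim: m => [|m IH]; first by rewrite mul1mx scale1r.
  by rewrite exprSr -mulmxE -mulmxA Ay -scalemxAr IH scalerA exprS.
(* Passing to the power k N makes the matrix positive on every periodic class. *)
have kN0 : (0 < k * N)%N by rewrite muln_gt0 k0.
have := AN N; rewrite -exprM => AkN.
have [|||a [ya aT past muN eqS]] :=
  dominant_eigenvector top_dominant rhoC0 kN0 _ _ y0 AkN.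
- exact: adjmx_exp_ge0.
- by [].
- by rewrite normrX exprM lerXn2r // nnegrE ?exprn_ge0 // ltW.
have /mem_top[i si ai] := aT.
have Ki := top_component (leq_trans si st) ai.
have [_ clP] := perK si; rewrite Ki in clP.
have [j jp aj] := cyclic_classes_cover clP (mem_scc D a).
have [_ _ cl1 _ _] := class_cell HN N0 si jp.
have [u [v [_ Pv]]] := top_perron si ai.
have [c c0 Hc] := vL_proportional si jp ai Pv.
have [v0 _ _] := Pv.
have sumE : `|\sum_z (A ^+ (k * N)) a z * y z 0| = \sum_z `|(A ^+ (k * N)) a z * y z 0|.
  have := congr1 (fun z : 'cV_n => `|z a 0|) AkN; rewrite !mxE => ->.
  rewrite normrM muN eqS ?mem_scc //; apply: eq_bigr => z _.
  by rewrite normrM ger0_norm // adjmx_exp_ge0.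
(* Equality in the triangle inequality gives all terms the same phase [e], hence [y] has constant
   phase on the class of [a]. *)
have [e /eqP e1 He] := normC_sum_eq sumE.
have yE z : z \in cl i j -> y z 0 = `|y z 0| * e.
  move=> zj; have Az : 0 < (A ^+ (k * N)) a z.
    rewrite adjmx_exp_gt0; have /dvdnP[q kq] := pk _ si; rewrite kq.
    rewrite [(q * _)%N]mulnC -mulnA; apply: HN zj => //.
    by rewrite leq_pmull //; move: k0; rewrite kq muln_gt0 => /andP[].
  have := He z isT; rewrite normrM (ger0_norm (ltW Az)) -mulrA.
  by apply: mulfI; rewrite gt_eqF.
have := congr1 (fun M : 'M_1 => M 0 0) (vLy i j si jp); rewrite !mxE.
(* Outside the class, [vL i j] lives strictly beyond [a], where [y] is zero. The remaining sum is
   positive, contradicting orthogonality. *)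
have -> : \sum_z vL i j 0 z * y z 0 = c * e * \sum_(z in cl i j) v z 0 * `|y z 0|.
  rewrite mulr_sumr [RHS]big_mkcond /=; apply: eq_bigr => z _.
  case: ifP => [zj|/negP zj].
    by rewrite Hc // {1}yE //; ring.
  have [->|vz] := eqVneq (vL i j 0 z) 0; first by rewrite mul0r.
  have [w wj wz] := vL_future si jp vz.
  have wS := cyclic_classes_sub clP jp wj.
  rewrite past ?mulr0 //.
    exact: walk_trans (scc_walk (mem_scc D a) wS) (walk_pow_walk wz).
  apply/negP => za; case: zj; apply: cl1 wj wz _.
  exact: walk_trans za (scc_walk (mem_scc D a) wS).
apply/eqP; rewrite !mulf_eq0 negb_or negb_or c0 -normr_eq0 e1 oner_eq0 /=.
rewrite gt_eqF // (bigD1 a) //= ltr_wpDr //.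
  apply: sumr_ge0 => z /andP[zj _]; rewrite mulr_ge0 // ltW // v0 //.
  exact: cyclic_classes_sub clP jp _ zj.
by rewrite mulr_gt0 ?normr_gt0 // v0 // mem_scc.
Qed.


(** If [p i] divides [k] the index returns to [j] and [vL_exp] is iterated; otherwise coherence
    moves the index by one for each factor [A]. *)
Lemma vL_shift i j k : (i < s)%N -> (j < p i)%N ->
    (~~ (p i %| k)%N -> coherent A rho (p i) (vL i)) ->
  vL i j *m A ^+ k = rho%:C ^+ k *: vL i ((j + k) %% p i)%N.
Proof.
move=> si jp; have [/dvdnP[q ->] _|_ /(_ isT) coh] := boolP (p i %| k)%N.
  rewrite addnC modnMDl modn_small // mulnC !exprM.
  elim: q => [|q IH]; first by rewrite mulmx1 scale1r.
  by rewrite exprS -mulmxE mulmxA vL_exp // -scalemxAl IH scalerA -exprS.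
have p0 := class_period_gt0 si.
elim: k => [|k IH]; first by rewrite mulmx1 scale1r addn0 modn_small.
rewrite exprSr -mulmxE mulmxA IH -scalemxAl coh ?ltn_pmod // scalerA -exprSr.
by congr (_ *: vL i _); rewrite -(addn1 ((j + k) %% p i)) modnDml addn1 addnS.
Qed.

Lemma top_asymptotics (wL : 'rV[R[i]]_n) (wR : 'cV[R[i]]_n) (k : nat) :
  let P := (\prod_(i < s) p i)%N in
  (forall i, (i < s)%N -> ~~ (p i %| k)%N -> coherent A rho (p i) (vL i)) ->
  exists (C eps : R) (q : nat -> R[i]), [/\ 0 < C, 0 < eps &
    forall m : nat,
      pairing (wL *m A ^+ (P * m + k)) wR =
        (q m + \sum_(i < s) \sum_(j < p i)
                 pairing wL (vR i j)
                 * pairing (vL i ((j + k) %% p i)%N) wR)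
        * rho%:C ^+ (P * m + k)
      /\ `|q m| < (C * (1 - eps) ^+ m)%:C].
Proof.
move=> P coh.
have pP i : (i < s)%N -> (p i %| P)%N.
  by move=> si; rewrite /P (bigD1 (Ordinal si)) //= dvdn_mulr.
have P0 : (0 < P)%N by rewrite prodn_gt0 // => i; apply: class_period_gt0.
have rhon0 e : rho%:C ^+ e != 0 by rewrite expf_neq0 // gt_eqF.
(* A dependent pair type turns the double sum into a single one, as [fixed_space_decay] expects. *)
pose I := {i : 'I_s & 'I_(p i)}.
pose l (x : I) := vL (tag x) (tagged x); pose r (x : I) := vR (tag x) (tagged x).
pose B := (rho%:C ^+ P)^-1 *: A ^+ P.
have lB (x : I) : l x *m B = l x.
  have [q Pq] := dvdnP (pP _ (ltn_ord (tag x))).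
  have := @vL_shift _ _ P (ltn_ord (tag x)) (ltn_ord (tagged x)).
  rewrite pP ?ltn_ord // /B -scalemxAr => ->; last by [].
  by rewrite scalerA mulVf // scale1r Pq addnC modnMDl modn_small.
have Br (x : I) : B *m r x = r x.
  have [q Pq] := dvdnP (pP _ (ltn_ord (tag x))).
  rewrite /B -scalemxAl; suff -> : A ^+ P *m r x = rho%:C ^+ P *: r x.
    by rewrite scalerA mulVf // scale1r.
  rewrite Pq mulnC !exprM; elim: q {Pq} => [|q IH]; first by rewrite mul1mx scale1r.
  by rewrite exprSr -mulmxE -mulmxA vR_exp ?ltn_ord // -scalemxAr IH scalerA -exprS.
have lr (x y : I) : l x *m r y = (x == y)%:R%:M.
  have [->|xy] := eqVneq x y.
    have [_ _] := eigK (ltn_ord (tag y)) (ltn_ord (tagged y)).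
    by rewrite /pairing => lr1; apply/matrixP=> a b; rewrite !ord1 lr1 mxE.
  rewrite raddf0; apply: vL_vR_orthogonal; rewrite ?ltn_ord //.
  apply: contraNN xy => /eqP[].
  case: x y => [i j] [i' j'] /= /val_inj ii'; subst i' => /val_inj ->.
  exact: eqxx.
have small a (y : 'cV[R[i]]_n) : y != 0 -> B *m y = a *: y ->
    (forall x, l x *m y = 0) -> `|a| < 1.
  move=> y0 By ly.
  have : `|a * rho%:C ^+ P| < rho%:C ^+ P.
    apply: (vL_annihilated_small P0 pP y0) => [|i j si jp].
      by rewrite mulrC -scalerA -By /B -scalemxAl scalerA divff // scale1r.
    exact: (ly (Tagged (fun i : 'I_s => 'I_(p i)) (Ordinal jp : 'I_(p (Ordinal si))))).
  rewrite normrM (ger0_norm (exprn_ge0 P (ltW rhoC0))).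
  by rewrite -[X in _ < X]mul1r ltr_pM2r ?exprn_gt0.
have [c [K0 [c0 c1 K00 HK]]] := fixed_space_decay lB Br lr small.
set Pi := \sum_x r x *m l x in HK.
(* The remaining [k] steps are absorbed into the right vector; on the [Pi] part they become the
   index shift by [k]. *)
pose z := (rho%:C ^+ k)^-1 *: (A ^+ k *m wR).
pose q m := (wL *m (B ^+ m - Pi) *m z) 0 0.
pose M := K0 * \sum_i \sum_j `|wL 0 j| * `|z i 0|.
have M0 : 0 <= M.
  by rewrite mulr_ge0 // sumr_ge0 // => i _; rewrite sumr_ge0 // => j _; rewrite mulr_ge0.
have qM m : `|q m| <= M * c ^+ m.
  rewrite /q mxE (le_trans (ler_norm_sum _ _ _)) // /M mulrAC mulr_sumr ler_sum // => i _.
  rewrite normrM mxE mulr_sumr.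
  apply: le_trans (ler_wpM2r (normr_ge0 _) (ler_norm_sum _ _ _)) _.
  rewrite mulr_suml ler_sum // => j _; rewrite normrM.
  have := ler_wpM2l (mulr_ge0 (normr_ge0 (wL 0 j)) (normr_ge0 (z i 0))) (HK m j i).
  by rewrite [X in X <= _ -> _]mulrAC [X in _ <= X -> _]mulrC.
have cR := RRe_real (gtr0_real c0); have MR := RRe_real (ger0_real M0).
(* Here 1 - eps is the decay rate [c], and the added 1 makes the bound strict. *)
exists (complex.Re M + 1), (1 - complex.Re c), q; split.
- by rewrite ltr_wpDl // -lecR MR.
- by rewrite subr_gt0 -ltcR cR.
move=> m; split; last first.
  apply: le_lt_trans (qM m) _.
  rewrite opprB addrCA subrr addr0 rmorphM rmorphXn rmorphD /= cR MR rmorph1.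
  by rewrite ltr_pM2r ?exprn_gt0 // ltrDl.
have Bm : A ^+ (P * m + k) *m wR = rho%:C ^+ (P * m + k) *: (B ^+ m *m z).
  have -> : B ^+ m = (rho%:C ^+ (P * m))^-1 *: A ^+ (P * m).
    elim: m => [|m IH]; first by rewrite muln0 !expr0 invr1 scale1r.
    rewrite exprS IH -mulmxE /B -scalemxAl -scalemxAr scalerA mulmxE -exprD -mulnS.
    by rewrite -invfM -exprD -mulnS.
  rewrite /z -scalemxAl -scalemxAr !scalerA mulmxA mulmxE -exprD.
  by rewrite -mulrA -invfM -exprD divff // scale1r.
rewrite /pairing -mulmxA Bm -scalemxAr mxE mulrC; congr (_ * _).
have -> : B ^+ m *m z = (B ^+ m - Pi) *m z + Pi *m z by rewrite mulmxBl subrK.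
rewrite mulmxDr mxE; congr (_ + _); first by rewrite /q mulmxA.
rewrite /Pi mulmx_suml mulmx_sumr summxE.
rewrite (sig_big_dep _ _ (fun (i : 'I_s) (j : 'I_(p i)) => (wL *m vR i j) 0 0 * (vL i ((j + k) %% p i)%N *m wR) 0 0)) /=.
apply: eq_bigr => x _; rewrite -(mulmxA (r x)) (mulmxA wL (r x)) [LHS]mxE big_ord1; congr (_ * _).
rewrite /l /z -scalemxAr mulmxA.
rewrite (vL_shift (ltn_ord _) (ltn_ord _) (coh _ (ltn_ord _))).
by rewrite -scalemxAl scalerA mulVf // scale1r.
Qed.

End Main.

(** The second conjunct shows that the coherence assumed in the first can always be reached by
    rescaling the [vL i j]; dividing the [vR i j] by the same scalars preserves the
    normalization. *)
Theorem mainTheorem15 (R : realType) (n : nat) (D : digraph n) (rho : R)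
  (s t : nat) (K : nat -> {set 'I_n}) (p : nat -> nat)
  (cl : nat -> nat -> {set 'I_n})
  (vL : nat -> nat -> 'rV[R[i]]_n) (vR : nat -> nat -> 'cV[R[i]]_n) :
  let A : 'M[R[i]]_n := adjmx R D in
  let P := (\prod_(i < s) p i)%N in
  let V i j := reach_set (D ^+ p i) (cl i j) in
  spectral_radius A = rho ->
  0 < rho ->
  (s <= t)%N ->
  (forall S, component D S <-> exists2 i, (i < t)%N & K i = S) ->
  (forall a b, (a < t)%N -> (b < t)%N -> K a = K b -> a = b) ->
  (forall i, (i < t)%N ->
    (spectral_radius (adjmx R (induced D (K i))) = rho <-> (i < s)%N)) ->
  (forall i, (i < s)%N ->
    is_period D (K i) (p i) /\ cyclic_classes D (K i) (p i) (cl i)) ->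
  (forall i j, (i < s)%N -> (j < p i)%N ->
    [/\ left_eigenvector (set_mask (V i j) (A ^+ p i)) (rho%:C ^+ p i) (vL i j),
        right_eigenvector (set_mask (V i j) (A ^+ p i)) (rho%:C ^+ p i) (vR i j)
      & pairing (vL i j) (vR i j) = 1]) ->
  (forall a b, (a < s)%N -> (b < s)%N -> a <> b ->
    forall u v, u \in K a -> v \in K b -> ~~ walk D u v) ->
  (forall (wL : 'rV[R[i]]_n) (wR : 'cV[R[i]]_n) (k : nat),
    (forall i, (i < s)%N -> ~~ (p i %| k)%N -> coherent A rho (p i) (vL i)) ->
    exists (C eps : R) (q : nat -> R[i]), [/\ 0 < C, 0 < eps &
      forall m : nat,
        pairing (wL *m A ^+ (P * m + k)) wR =
          (q m + \sum_(i < s) \sum_(j < p i)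
                   pairing wL (vR i j)
                   * pairing (vL i ((j + k) %% p i)%N) wR)
          * rho%:C ^+ (P * m + k)
        /\ `|q m| < (C * (1 - eps) ^+ m)%:C]) /\
  (exists c : nat -> nat -> R[i],
    (forall i j, (i < s)%N -> (j < p i)%N -> c i j != 0) /\
    (forall i, (i < s)%N ->
      coherent A rho (p i) (fun j => c i j *: vL i j))).
Proof.
move=> A P V radA rho0 st compK injK topK perK eigK sepK; split.
  move=> wL wR k; exact: (top_asymptotics radA rho0 st compK topK perK eigK sepK).
have [c Hc] : exists c : 'I_s -> nat -> R[i], forall i : 'I_s,
    (forall j, (j < p i)%N -> c i j != 0) /\
    coherent A rho (p i) (fun j => c i j *: vL i j).
  apply: (fin_all_exists (P := fun (i : 'I_s) (c : nat -> R[i]) =>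
    (forall j, (j < p i)%N -> c j != 0) /\
    coherent A rho (p i) (fun j => c j *: vL i j))) => i.
  exact: (coherent_rescaling radA rho0 st compK topK perK eigK sepK (ltn_ord i)).
exists (fun i j => if insub i is Some o then c o j else 0); split=> [i j si jp|i si].
  by rewrite insubT; case: (Hc (Sub i si)) => H _; apply: H.
by rewrite insubT; case: (Hc (Sub i si)).
Qed.
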